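(* Let $D\ge2$. (i) There is a unique algebra homomorphism $\Re\to\mathbf R$ sending \[ A\mapsto \tfrac D{16}-\tfrac14+\tfrac{\mathbf A_2^J+\mathbf A_2^{\bar J}}{8},\qquad B\mapsto \tfrac D{16}-\tfrac14+\tfrac{\mathbf A_2^*}{8},\qquad C\mapsto \tfrac D{16}-\tfrac14+\tfrac{\mathbf A_2^J-\mathbf A_2^{\bar J}}{8}, \] and this homomorphism is surjective. (ii) $\mathbf A_2^J+\mathbf A_2^{\bar J}$, $\mathbf A_2^*$, $\mathbf A_2^J-\mathbf A_2^{\bar J}$ act on each irreducible $\mathbf R$-module as a Leonard triple.
   Context: $\Re$ is the unital associative $\mathbb C$-algebra generated by $A,B,C,\Delta$ with $[A,B]=[B,C]=[C,A]=2\Delta$ and such that $[A,\Delta]+AC-BA$, $[B,\Delta]+BA-CB$, $[C,\Delta]+CB-AC$ are central. Let $X$ be the power set of a $D$-element set, and for $x,y\in X$ write $(x,y)\in R_2$ if $|x\triangle y|=2$ (distance $2$ in the hypercube $H(D,2)$). $\mathbb C^X$ is the vector space with basis $X$. Define linear maps on $\mathbb C^X$ by $\mathbf A_2^Jx=\sum_{|y|=|x|,(x,y)\in R_2}y$, $\mathbf A_2^{\bar J}x=\sum_{|y|\ne|x|,(x,y)\in R_2}y$, and $\mathbf A_2^*x=\frac{(D-2|x|)^2-D}{2}x$ for $x\in X$. $\mathbf R$ is the subalgebra of $\mathrm{End}(\mathbb C^X)$ generated by $\mathbf A_2^J,\mathbf A_2^{\bar J},\mathbf A_2^*$. An ordered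 triple $L,L^*,L^\varepsilon$ of linear operators on a finite-dimensional nonzero space $W$ is a Leonard triple if for each of the three operators there is a basis of $W$ in which that operator is diagonal and the other two are irreducible tridiagonal (all nonzero entries on the diagonal, subdiagonal or superdiagonal, with all sub- and superdiagonal entries nonzero). *)

(* Defs.v *)
From HB Require Import structures.
From mathcomp Require Import all_boot all_algebra.
From mathcomp Require Import reals.
From mathcomp Require Export complex.
Set Implicit Arguments. Unset Strict Implicit. Unset Printing Implicit Defensive.
Import GRing.Theory.
Local Open Scope ring_scope.

Section Defs.
Variable F : fieldType.

Definition comm (S : algType F) (x y : S) : S := x * y - y * x.

(** The defining relations of the algebra \Re on candidate images a,b,c,d of
    the generators A,B,C,Delta:  [a,b]=[b,c]=[c,a]=2d, and the three elements
    [a,d]+ac-ba, [b,d]+ba-cb, [c,d]+cb-ac are central, i.e. commute with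
    all generators. *)
Definition Re_rel (S : algType F) (a b c d : S) : Prop :=
  [/\ comm a b = 2%:R * d, comm b c = 2%:R * d, comm c a = 2%:R * d &
      forall e g, e \in [:: comm a d + a * c - b * a;
                            comm b d + b * a - c * b;
                            comm c d + c * b - a * c] ->
                  g \in [:: a; b; c; d] -> e * g = g * e].

Definition is_alg_hom (S T : algType F) (f : S -> T) : Prop :=
  [/\ forall x y, f (x + y) = f x + f y,
      forall (k : F) x, f (k *: x) = k *: f x,
      forall x y, f (x * y) = f x * f y & f 1 = 1].

(** (Re, A, B, C, Dl) is a presentation of \Re: the generators satisfy the
    relations and every quadruple satisfying them in an F-algebra is the image
    of the generators under exactly one algebra homomorphism
    (universal property of the algebra given by generators and relations). *)
Definition is_Re_presentation (Re : algType F) (A B C Dl : Re) : Prop :=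
  Re_rel A B C Dl /\
  forall (S : algType F) (a b c d : S), Re_rel a b c d ->
    (exists f : Re -> S,
        [/\ is_alg_hom f, f A = a, f B = b, f C = c & f Dl = d]) /\
    (forall f g : Re -> S, is_alg_hom f -> is_alg_hom g ->
        f A = g A -> f B = g B -> f C = g C -> f Dl = g Dl -> f =1 g).

(** The hypercube H(D,2): X = subsets of a D-element set, enumerated as
    'I_((Xn D).+1) (note (Xn D).+1 = #|X| = 2^D). *)
Definition Xn (D : nat) : nat := (#|{set 'I_D}|).-1.
Definition pt (D : nat) (i : 'I_((Xn D).+1)) : {set 'I_D} :=
  nth set0 (enum {set 'I_D}) i.
Definition dist2 (D : nat) (x y : {set 'I_D}) : bool :=
  #|(x :\: y) :|: (y :\: x)| == 2%N.

(** Operators on C^X, as matrices acting on column vectors: entry (i,j) is the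
    coefficient of pt i in the image of pt j. *)
Definition A2J (D : nat) : 'M[F]_((Xn D).+1) :=
  \matrix_(i, j) (dist2 (pt i) (pt j) && (#|pt i| == #|pt j|))%:R.
Definition A2Jbar (D : nat) : 'M[F]_((Xn D).+1) :=
  \matrix_(i, j) (dist2 (pt i) (pt j) && (#|pt i| != #|pt j|))%:R.
Definition A2star (D : nat) : 'M[F]_((Xn D).+1) :=
  \matrix_(i, j) ((i == j)%:R *
     (((D%:R - 2%:R * (#|pt j|)%:R) ^+ 2 - D%:R) / 2%:R)).

Inductive gen_alg (n : nat) (g1 g2 g3 : 'M[F]_n) : 'M[F]_n -> Prop :=
| ga_g1 : gen_alg g1 g2 g3 g1
| ga_g2 : gen_alg g1 g2 g3 g2
| ga_g3 : gen_alg g1 g2 g3 g3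
| ga_one : gen_alg g1 g2 g3 1%:M
| ga_add M N : gen_alg g1 g2 g3 M -> gen_alg g1 g2 g3 N -> gen_alg g1 g2 g3 (M + N)
| ga_scale (k : F) M : gen_alg g1 g2 g3 M -> gen_alg g1 g2 g3 (k *: M)
| ga_mul M N : gen_alg g1 g2 g3 M -> gen_alg g1 g2 g3 N -> gen_alg g1 g2 g3 (M *m N).

Definition inR (D : nat) : 'M[F]_((Xn D).+1) -> Prop :=
  gen_alg (A2J D) (A2Jbar D) (A2star D).

Definition imgA (D : nat) : 'M[F]_((Xn D).+1) :=
  (D%:R / 16%:R - 4%:R^-1)%:M + 8%:R^-1 *: (A2J D + A2Jbar D).
Definition imgB (D : nat) : 'M[F]_((Xn D).+1) :=
  (D%:R / 16%:R - 4%:R^-1)%:M + 8%:R^-1 *: A2star D.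
Definition imgC (D : nat) : 'M[F]_((Xn D).+1) :=
  (D%:R / 16%:R - 4%:R^-1)%:M + 8%:R^-1 *: (A2J D - A2Jbar D).

(** A (unital, left) module structure of the subalgebra P of 'M_n on the
    space W = 'cV_m (column vectors, v |-> rho r *m v). *)
Definition is_module (n m : nat) (P : 'M[F]_n -> Prop) (rho : 'M[F]_n -> 'M[F]_m) :=
  (forall r s, P r -> P s -> rho (r + s) = rho r + rho s) /\
  (forall (k : F) r, P r -> rho (k *: r) = k *: rho r) /\
  (forall r s, P r -> P s -> rho (r *m s) = rho r *m rho s) /\
  rho 1%:M = 1%:M.

(** Irreducibility: every P-invariant subspace (spanned by the columns of U)
    is zero or everything. *)
Definition is_irreducible (n m : nat) (P : 'M[F]_n -> Prop) (rho : 'M[F]_n -> 'M[F]_m) :=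
  forall U : 'M[F]_m,
    (forall r, P r -> exists Y : 'M[F]_m, rho r *m U = U *m Y) ->
    U = 0 \/ \rank U = m.

Definition irr_tridiag (m : nat) (M : 'M[F]_m) : Prop :=
  forall i j : 'I_m,
    ((i.+1 < j)%N || (j.+1 < i)%N -> M i j = 0) /\
    ((i.+1 == j) || (j.+1 == i) -> M i j != 0).

Definition lt_cond (m : nat) (X Y Z : 'M[F]_m) : Prop :=
  exists P : 'M[F]_m, [/\ P \in unitmx,
    is_diag_mx (invmx P *m X *m P),
    irr_tridiag (invmx P *m Y *m P) &
    irr_tridiag (invmx P *m Z *m P)].

Definition leonard_triple (m : nat) (L Ls Le : 'M[F]_m) : Prop :=
  [/\ lt_cond L Ls Le, lt_cond Ls Le L & lt_cond Le L Ls].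

End Defs.

(* Main.v *)
Require Import Defs.
From HB Require Import structures.
From mathcomp Require Import all_boot all_order all_algebra.
From mathcomp Require Import reals complex boolp.
From mathcomp Require Import ring zify.
Set Implicit Arguments. Unset Strict Implicit. Unset Printing Implicit Defensive.
Import Order.TTheory GRing.Theory Num.Theory.
Local Open Scope ring_scope.

(** Let [X] be the adjacency matrix of the hypercube, [H] the diagonal matrix
    with entries [D - 2|s|] and [Y = (i/2) [H, X]]. Then [X], [Y], [H] satisfy
    the relations of so(3), and [x = X^2], [y = Y^2], [z = H^2] are the affine
    images [2 M + D] of [A2J + A2Jbar], [A2J - A2Jbar], [A2star]. In such a
    triple of squares [x + y + z] is central and
    [[x,[x,y]] = 16 (x (y - z) + (y - z) x) - 128 (y - z)] holds cyclically:
    these are the relations of Re, with all three central elements equal to 0.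

    On an irreducible module [x + y + z] is a scalar, so everything is governed
    by [z] and [N = (x - y)/2]. The relations say that [N] maps the
    [h^2]-eigenspace of [z] into the sum of those for [(h + 4)^2] and
    [(h - 4)^2], and that going up and then down is a scalar as soon as going
    down and then up is. Hence an eigenvector [v_0] at the bottom of a ladder
    [h, h + 4, h + 8, ...] generates a submodule with basis [v_0, v_1, ...] in
    which [z] is diagonal and [N] is tridiagonal. The bottom is a weight [h]
    such that [h - 4] is no weight, or one of the weights 0 and 2, where the
    ladder folds: from 0 both neighbours have the same square 16, and from 2
    the descending part of [N] maps the eigenspace to itself, so [v_0] is chosen
    as an eigenvector of that map. The eigenvalues of [z] are
    read off the diagonal; [x] and [y] are conjugate to [z] by the Walsh
    matrix and a diagonal matrix of powers of [i]. *)

(** * Entrywise expansion of matrix identities *)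

Section EntrywiseLinearity.
Variables (F : comNzRingType) (m n : nat).
Implicit Types A B : 'M[F]_(m, n).
Lemma addmxE A B i j : (A + B) i j = A i j + B i j. Proof. by rewrite mxE. Qed.
Lemma oppmxE A i j : (- A) i j = - A i j. Proof. by rewrite mxE. Qed.
Lemma scalemxE (k : F) A i j : (k *: A) i j = k * A i j.
Proof. by rewrite mxE. Qed.
Lemma zeromxE i j : (0 : 'M[F]_(m, n)) i j = 0. Proof. by rewrite mxE. Qed.
End EntrywiseLinearity.
Definition mxlinE := (addmxE, oppmxE, scalemxE, zeromxE).
Definition mxexpand := (mulmxDl, mulmxDr, mulmxN, mulNmx, mulmxA,
  =^~ scalemxAl, =^~ scalemxAr).

Ltac mxring := apply/matrixP=> ? ?; rewrite ?mxexpand !mxlinE; ring.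

(** * Squares of an so(3) triple *)

Section Racah.
Variables (F : fieldType) (n : nat).
Implicit Types x y z X Y Z : 'M[F]_n.

Definition racah_rel x y z : Prop :=
  x *m x *m y - 2%:R *: (x *m y *m x) + y *m x *m x =
  16%:R *: (x *m (y - z) + (y - z) *m x) - 128%:R *: (y - z).

(* [ad X] acts on the span of [Y^2 - Z^2] and [YZ + ZY] with square [16]. *)
Lemma so3_racah_rel X Y Z (w : F) : w ^+ 2 = -1 ->
  X *m Y - Y *m X = (2%:R * w) *: Z -> Z *m X - X *m Z = (2%:R * w) *: Y ->
  racah_rel (X *m X) (Y *m Y) (Z *m Z).
Proof.
move=> w2 hXY hZX.
have XY : X *m Y = Y *m X + (2%:R * w) *: Z by rewrite -hXY addrC subrK.
have XZ : X *m Z = Z *m X - (2%:R * w) *: Y.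
  by rewrite -hZX opprB addrC subrK.
have XYr k (B : 'M_(n, k)) : X *m (Y *m B) = Y *m (X *m B) + (2%:R * w) *: (Z *m B).
  by rewrite mulmxA XY mulmxDl -scalemxAl -mulmxA.
have XZr k (B : 'M_(n, k)) : X *m (Z *m B) = Z *m (X *m B) - (2%:R * w) *: (Y *m B).
  by rewrite mulmxA XZ mulmxDl mulNmx -scalemxAl -mulmxA.
rewrite /racah_rel -!mulmxA.
(* Normal form: every [X] is pushed to the right past [Y] and [Z], whose own order is kept. What
   remains is an identity between entries of normal words, modulo [w ^+ 2 = -1]. *)
do 5 (rewrite ?(XYr, XZr, XY, XZ); rewrite ?(mulmxDl, mulmxDr, mulmxN, mulNmx,
  =^~ scalemxAl, =^~ scalemxAr) -?mulmxA).
apply/matrixP=> i j; rewrite !mxlinE.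
ring: w2.
Qed.

(** [X] already commutes with the sum: [[X, Y^2] = 2w(YZ + ZY)] and [[X, Z^2]] is its opposite. *)
Lemma so3_casimir_comm X Y Z (w : F) :
  X *m Y - Y *m X = (2%:R * w) *: Z -> Z *m X - X *m Z = (2%:R * w) *: Y ->
  comm_mx (X *m X) (X *m X + Y *m Y + Z *m Z).
Proof.
move=> hXY hZX.
have XY : X *m Y = Y *m X + (2%:R * w) *: Z by rewrite -hXY addrC subrK.
have XZ : X *m Z = Z *m X - (2%:R * w) *: Y.
  by rewrite -hZX opprB addrC subrK.
have h : comm_mx X (X *m X + Y *m Y + Z *m Z).
  rewrite /comm_mx !mulmxDr !mulmxDl !mulmxA XY XZ !mulmxDl !mulNmx -!scalemxAl.
  rewrite -!mulmxA XY XZ; mxring.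
by apply/comm_mx_sym/comm_mxM; apply: comm_mx_sym.
Qed.

End Racah.

(** Reduces a linear consequence of [c = d] to the polynomial identity [a - b = c - d], which [ring]
    or [field] decides. *)
Lemma eq_of_subr_eq (V : zmodType) (a b c d : V) :
  c = d -> a - b = c - d -> a = b.
Proof. by move=> ->; rewrite subrr => /eqP; rewrite subr_eq0 => /eqP. Qed.

Lemma mulmx_colE (R : pzRingType) m n p (A : 'M[R]_(m, n)) (U : 'M_(n, p)) j :
  col j (A *m U) = A *m col j U.
Proof. by rewrite !colE mulmxA. Qed.

Lemma eq_col (R : Type) m n (A B : 'M[R]_(m, n)) :
  (forall j, col j A = col j B) -> A = B.
Proof.
by move=> h; apply/matrixP => i j; have /colP/(_ i) := h j; rewrite !mxE.
Qed.

Lemma mul_col (R : comPzRingType) m n p (U : 'M[R]_(m, n)) (T : 'M_(n, p)) j :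
  col j (U *m T) = \sum_i T i j *: col i U.
Proof.
apply/colP => i; rewrite !mxE summxE.
by apply: eq_bigr => k _; rewrite !mxE mulrC.
Qed.

(** [eigenvalue] concerns row vectors; transposition keeps the characteristic polynomial. *)
Lemma eigenvalue_col (F : fieldType) n (A : 'M[F]_n) a (v : 'cV_n) :
  v != 0 -> A *m v = a *: v -> root (char_poly A) a.
Proof.
move=> v0 e; have -> : char_poly A = char_poly A^T.
  rewrite /char_poly -det_tr /char_poly_mx; congr (\det _).
  by apply/matrixP => i j; rewrite !mxE eq_sym.
rewrite -eigenvalue_root_char; apply/eigenvalueP; exists v^T.
  by rewrite -trmx_mul e linearZ.
by apply: contraNneq v0 => e'; rewrite -(trmxK v) e' trmx0.
Qed.

(** * The ladder of eigenvectors *)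

Section Chain.
Variables (F : numFieldType) (m : nat) (z N : 'M[F]_m.+1).
Variables (a2 a1 a0 t lam : F) (w0 w1 : 'cV[F]_m.+1).

(** The weights of the ladder: [z] acts on the [k]-th vector by [node k ^+ 2]. *)
Definition node (k : nat) : F := t + 4%:R * k%:R.

Hypothesis relN : 2%:R *: (N *m z *m N) - N *m N *m z - z *m N *m N
  + 32%:R *: (N *m N) = a2 *: (z *m z) + a1 *: z + a0%:M.
Hypothesis irr : forall U : 'M[F]_m.+1, (exists Y, z *m U = U *m Y) ->
  (exists Y, N *m U = U *m Y) -> U = 0 \/ \rank U = m.+1.
Hypothesis node_inj : injective (fun k => node k ^+ 2).
Hypothesis w0_neq0 : w0 != 0.
Hypothesis z_w0 : z *m w0 = (t ^+ 2) *: w0.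
Hypothesis N_w0 : N *m w0 = w1 + lam *: w0.
Hypothesis z_w1 : z *m w1 = ((t + 4%:R) ^+ 2) *: w1.
Hypothesis lam_t : lam * (t - 2%:R) = 0.

Let phi (b : F) : F := a2 * b ^+ 2 + a1 * b + a0.

(* [chain k] is [(v_k, v_(k+1), c_(k+1))], where [N v_(k+1) = v_(k+2) + c_(k+1) v_k]. *)
Fixpoint chain (k : nat) : 'cV[F]_m.+1 * 'cV[F]_m.+1 * F :=
  if k is k'.+1 then
    let: (v, v', c) := chain k' in
    (v', N *m v' - c *: v,
     (phi (node k ^+ 2) + 16%:R * node k' * c) / (16%:R * node k.+1))
  else (w0, w1, (phi (node 0 ^+ 2) - 32%:R * lam ^+ 2) / (16%:R * node 1)).

Definition chainv k := (chain k).1.1.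
Definition chainc k := (chain k).2.

Lemma chainvS k : chainv k.+1 = (chain k).1.2.
Proof. by rewrite /chainv /=; case: (chain k) => [[]]. Qed.

Lemma chainvSS k : chainv k.+2 = N *m chainv k.+1 - chainc k *: chainv k.
Proof. by rewrite !chainvS /chainv /chainc /=; case: (chain k) => [[]]. Qed.

Lemma chaincS k : chainc k.+1 =
  (phi (node k.+1 ^+ 2) + 16%:R * node k * chainc k) / (16%:R * node k.+2).
Proof. by rewrite /chainc /=; case: (chain k) => [[]]. Qed.

Lemma nodeS k : node k.+1 = node k + 4%:R.
Proof. by rewrite /node -natr1; ring. Qed.

(** A zero node would have -4 and 4 as its neighbours, with equal squares. *)
Lemma node_neq0 k : node k.+1 != 0.
Proof.
apply/eqP => e; have /node_inj/eqP : node k ^+ 2 = node k.+2 ^+ 2.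
  by move/eqP: e; rewrite !nodeS addr_eq0 => /eqP ->; ring.
by rewrite -addn2 -{1}[k]addn0 eqn_add2l.
Qed.

Lemma relN_eigen (v : 'cV[F]_m.+1) b : z *m v = b *: v ->
  phi b *: v = 2%:R *: (N *m (z *m (N *m v))) - b *: (N *m (N *m v))
   - z *m (N *m (N *m v)) + 32%:R *: (N *m (N *m v)).
Proof.
move=> zv; have := congr1 (mulmx^~ v) relN.
rewrite /= !mulmxDl !mulNmx -!scalemxAl -!mulmxA zv mul_scalar_mx.
rewrite -!scalemxAr zv => ->.
by rewrite /phi; mxring.
Qed.

(** The four identities are proved together by induction. The coefficients [16 node] are the
    differences [(a + 4)^2 - (a - 4)^2] of neighbouring eigenvalues. [relN_eigen] at [v_(k+1)]
    determines [z N v_(k+2)], and [c_(k+1)] is the scalar that it yields. *)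
Lemma chain_spec k :
  [/\ z *m chainv k = (node k ^+ 2) *: chainv k,
      z *m chainv k.+1 = (node k.+1 ^+ 2) *: chainv k.+1,
      z *m (N *m chainv k.+1) = (node k.+2 ^+ 2) *: (N *m chainv k.+1)
         - (16%:R * node k.+1 * chainc k) *: chainv k &
      z *m (N *m chainv k) = ((node k - 4%:R) ^+ 2) *: (N *m chainv k)
         + (16%:R * node k) *: chainv k.+1].
Proof.
have n16 : (16%:R : F) != 0 by rewrite pnatr_eq0.
elim: k => [|k [zv zv' zN' zN]].
  rewrite chainvS /chainv /chainc /=.
  have n0 : node 0 = t by rewrite /node mulr0 addr0.
  have zw0 : z *m w0 = (node 0 ^+ 2) *: w0 by rewrite n0.
  have zw1 : z *m w1 = (node 1 ^+ 2) *: w1 by rewrite nodeS n0.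
  have zNw0 : z *m (N *m w0) =
    ((node 0 - 4%:R) ^+ 2) *: (N *m w0) + (16%:R * node 0) *: w1.
    rewrite N_w0 mulmxDr -scalemxAr zw0 zw1 nodeS n0.
    (* Either [lam = 0] or [t = 2]; in the latter case [t - 4] and [t] have the same square, so
       [lam *: w0] has the eigenvalue of the descending part. *)
    have e : lam * t = lam * 2%:R by rewrite -[LHS]subr0 -lam_t; ring.
    apply/matrixP => i j; rewrite !mxlinE; ring: e.
  split=> //.
  rewrite mulrC divfK ?mulf_neq0 ?node_neq0 //.
  have := relN_eigen zw0; rewrite N_w0 !mulmxDr -?scalemxAr z_w0 z_w1.
  rewrite ?mulmxDr -?scalemxAr N_w0 ?mulmxDr -?scalemxAr ?z_w0 ?z_w1 => h.
  apply/matrixP => i j; move/matrixP/(_ i j): h; rewrite !mxlinE !nodeS n0.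
  have e : lam * t = lam * 2%:R by rewrite -[LHS]subr0 -lam_t; ring.
  move=> h; apply: (eq_of_subr_eq h); ring: e.
have zv2 : z *m chainv k.+2 = (node k.+2 ^+ 2) *: chainv k.+2.
  by rewrite chainvSS mulmxBr zN' -scalemxAr zv !nodeS; mxring.
have Nv : N *m chainv k.+1 = chainv k.+2 + chainc k *: chainv k.
  by rewrite chainvSS subrK.
split=> //.
- rewrite chaincS mulrC divfK ?mulf_neq0 ?node_neq0 //.
  have := relN_eigen zv'; rewrite Nv !mulmxDr -?scalemxAr zv zv2.
  rewrite ?mulmxDr -?scalemxAr zN => h.
  apply/matrixP => i j; move/matrixP/(_ i j): h; rewrite !mxlinE !nodeS.
  move=> h; apply: (eq_of_subr_eq h); ring.
- rewrite Nv mulmxDr -scalemxAr zv2 zv !nodeS; mxring.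
Qed.

Lemma z_chainv k : z *m chainv k = (node k ^+ 2) *: chainv k.
Proof. by have [] := chain_spec k. Qed.

Lemma N_chainv k : N *m chainv k.+1 = chainv k.+2 + chainc k *: chainv k.
Proof. by rewrite chainvSS subrK. Qed.

(** If [v_(k+1) = 0], the third identity of [chain_spec] leaves [c_k v_k = 0], and
    [v_(k+2) = N v_(k+1) - c_k v_k]. So the vectors vanish from the first zero on. *)
Lemma chainv_eq0S k : (0 < k)%N -> chainv k = 0 -> chainv k.+1 = 0.
Proof.
case: k => // k _ e; have [_ _ zN' _] := chain_spec k.
move: zN'; rewrite e mulmx0 mulmx0 scaler0 add0r => /eqP.
rewrite eq_sym oppr_eq0 scaler_eq0 => ce.
rewrite chainvSS e mulmx0 add0r; apply/eqP; rewrite oppr_eq0 scaler_eq0.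
by move: ce; rewrite !mulf_eq0 (negPf (node_neq0 _)) pnatr_eq0 /= ?orbF.
Qed.

(** Otherwise [v_0, ..., v_(m+1)] would be eigenvectors for [m + 2] distinct roots of a
    characteristic polynomial of degree [m + 1]. *)
Lemma chainv_top : chainv m.+1 = 0.
Proof.
apply/eqP; apply/negPn/negP => top.
have nz k : (k <= m.+1)%N -> chainv k != 0.
  case: k => [//|k] le; apply/eqP => e.
  suff : forall j, chainv (k.+1 + j) = 0.
    by move=> /(_ (m - k)%N); rewrite addSn subnKC // => /eqP; apply/negP.
  elim=> [|j IH]; first by rewrite addn0.
  by rewrite addnS; apply: chainv_eq0S.
pose rs := [seq node k ^+ 2 | k <- iota 0 m.+2].
have := @max_poly_roots _ (char_poly z) rs.
rewrite size_char_poly size_map size_iota ltnn => H; suff : false by [].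
apply: H; first by rewrite -size_poly_gt0 size_char_poly.
  apply/allP => y /mapP[k]; rewrite mem_iota add0n => /andP[_ lk] ->.
  by apply: eigenvalue_col (nz k _) (z_chainv k).
by rewrite map_inj_uniq ?iota_uniq.
Qed.

(** The matrix of [N] on [v_0, ..., v_m]. The corner entry [lam] accounts for the fold at weight
    2. *)
Definition trid : 'M[F]_m.+1 := \matrix_(i, j)
  (if (i == j.+1 :> nat) then 1 else
   if (i.+1 == j :> nat) then chainc i else
   if (i == 0%N :> nat) && (j == 0%N :> nat) then lam else 0).

(** The columns span [v_p, ..., v_m]; zero columns keep the matrix square, as the irreducibility
    test demands. [p = 0] gives the basis, [p > 0] candidate submodules. *)
Definition tailmx (p : nat) : 'M[F]_m.+1 :=
  \matrix_(i, j) (if (p <= j)%N then chainv j i 0 else 0).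

Lemma col_tailmx p j : col j (tailmx p) = if (p <= j)%N then chainv j else 0.
Proof. by apply/colP => i; rewrite !mxE; case: ifP; rewrite ?mxE. Qed.

Lemma tailmx_z p : z *m tailmx p = tailmx p *m diag_mx (\row_j (node j ^+ 2)).
Proof.
apply/matrixP => i j; rewrite mul_mx_diag.
have -> : (z *m tailmx p) i j = (z *m col j (tailmx p)) i 0.
  by rewrite colE mulmxA -colE [RHS]mxE.
rewrite col_tailmx [RHS]mxE [tailmx p i j]mxE (mxE _ _ _ j).
case: ifP => pj; last by rewrite mul0r mulmx0 mxE.
by rewrite z_chainv mxE mulrC.
Qed.

Lemma N_chainv_trid (j : 'I_m.+1) :
  N *m chainv j = \sum_(i < m.+1) trid i j *: chainv i.
Proof.
have sumE (g : nat -> 'cV[F]_m.+1) (k : nat) :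
    \sum_(i < m.+1) (i == k :> nat)%:R *: g i = if (k <= m)%N then g k else 0.
  case: ifP => km; last first.
    rewrite big1 // => i _; case: eqP => [e|_]; rewrite ?scale0r //.
    by move: km; rewrite -e -ltnS ltn_ord.
  rewrite (bigD1 (Ordinal (km : (k < m.+1)%N))) //= eqxx scale1r big1 ?addr0 // => i.
  by rewrite -val_eqE /= => /negPf ->; rewrite scale0r.
have next : (if (j.+1 <= m)%N then chainv j.+1 else 0) = chainv j.+1.
  case: ifP => // jm; have -> : j.+1 = m.+1 :> nat by have := ltn_ord j; lia.
  by rewrite chainv_top.
case: j next => [[|j] lj] /= next.
- rewrite (eq_bigr (fun i : 'I_m.+1 => (i == 1%N :> nat)%:R *: chainv i
    + lam *: ((i == 0%N :> nat)%:R *: chainv i))).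
    by rewrite big_split -scaler_sumr !sumE /= next.
  move=> [[|[|i]] li] _; rewrite mxE //= ?scale1r ?scale0r ?scaler0 ?addr0 ?add0r //.
rewrite (eq_bigr (fun i : 'I_m.+1 => (i == j.+2 :> nat)%:R *: chainv i
    + chainc j *: ((i == j :> nat)%:R *: chainv i))).
  rewrite big_split -scaler_sumr !sumE /= next N_chainv.
  by rewrite ifT //; lia.
move=> i _; rewrite mxE /= eqSS andbF.
case: (i =P j.+2 :> nat) => [e|_].
  have -> : (i == j :> nat) = false by lia.
  by rewrite scale0r scaler0 addr0.
by case: (i =P j :> nat) => [->|_]; rewrite ?scale1r !scale0r ?scaler0 ?add0r ?addr0.
Qed.

(** The only way out of the tail under [N] is the term [c_(p-1) v_(p-1)] of [N v_p]. *)
Lemma tailmx_N p : (0 < p)%N -> chainc p.-1 = 0 ->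
  N *m tailmx p = tailmx p *m (\matrix_(i, j) (if (p <= j)%N then trid i j else 0)).
Proof.
move=> p0 cp; apply: eq_col => j; rewrite mulmx_colE mul_col col_tailmx.
case: ifP => pj; last first.
  by rewrite mulmx0 big1 // => k _; rewrite mxE pj scale0r.
rewrite N_chainv_trid; apply: eq_bigr => k _; rewrite [in RHS]mxE pj col_tailmx.
case: ifP => // pk; rewrite mxE.
have kp : (k < p)%N by rewrite ltnNge pk.
rewrite ifF; last by lia.
case: eqP => [e|_]; last by rewrite ifF ?scale0r //; lia.
have -> : (k : nat) = p.-1 by lia.
by rewrite cp scale0r scaler0.
Qed.

Lemma tailmx0_N : N *m tailmx 0 = tailmx 0 *m trid.
Proof.
apply: eq_col => j; rewrite mulmx_colE mul_col col_tailmx.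
by rewrite N_chainv_trid; apply: eq_bigr => k _; rewrite col_tailmx.
Qed.

Lemma tailmx0_unit : tailmx 0 \in unitmx.
Proof.
rewrite -row_free_unit /row_free.
case: (@irr (tailmx 0)); last by move=> ->.
- by eexists; exact: tailmx_z.
- by eexists; exact: tailmx0_N.
move=> e; have := col_tailmx 0 ord0; rewrite e linear0.
by move=> /esym/eqP w00; case/negP: w0_neq0.
Qed.

(** If [c_k = 0], the tail from [k + 1] is invariant, nonzero, and proper because its first column
    is zero. *)
Lemma chainc_neq0 k : (k < m)%N -> chainc k != 0.
Proof.
move=> km; apply/eqP => ck.
have cols (j : 'I_m.+1) : chainv j != 0.
  have := tailmx0_unit; apply: contraTneq => vj; rewrite unitmxE.
  rewrite (expand_det_col _ j) big1 ?unitr0 // => i _.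
  have /colP/(_ i) := col_tailmx 0 j; rewrite !mxE /= vj mxE => ->.
  by rewrite mul0r.
case: (@irr (tailmx k.+1)).
- by eexists; exact: tailmx_z.
- by eexists; exact: tailmx_N.
- move=> e; have := col_tailmx k.+1 (Ordinal (km : (k.+1 < m.+1)%N)).
  rewrite e linear0 /= leqnn => /esym/eqP; apply/negP.
  exact: (cols (Ordinal (km : (k.+1 < m.+1)%N))).
move=> /eqP rk; have : tailmx k.+1 \in unitmx by rewrite -row_free_unit.
rewrite unitmxE (expand_det_col _ ord0) big1 ?unitr0 // => i _.
by have /colP/(_ i) := col_tailmx k.+1 ord0; rewrite !mxE /= => ->; rewrite mul0r.
Qed.

Lemma chain_diag_trid : exists P : 'M[F]_m.+1,
  [/\ P \in unitmx, is_diag_mx (invmx P *m z *m P) & irr_tridiag (invmx P *m N *m P)].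
Proof.
exists (tailmx 0); have uP := tailmx0_unit; split=> //.
  by rewrite -mulmxA tailmx_z mulKmx // diag_mx_is_diag.
rewrite -mulmxA tailmx0_N mulKmx // => i j; rewrite mxE; split=> h.
  by rewrite !ifF //; lia.
case: (nat_of_ord i =P j.+1) => [_|ne]; first exact: oner_neq0.
case: (i.+1 =P j :> nat) => [e|ne']; last by lia.
by apply: chainc_neq0; have := ltn_ord j; lia.
Qed.

End Chain.

(** * Eigenvectors and annihilating products *)

Lemma stable_ker_eigencol (F : numClosedFieldType) n (A B : 'M[F]_n) (v0 : 'cV_n) :
  v0 != 0 -> B *m v0 = 0 ->
  (forall v : 'cV_n, B *m v = 0 -> B *m (A *m v) = 0) ->
  exists a, exists v : 'cV_n, [/\ v != 0, B *m v = 0 & A *m v = a *: v].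
Proof.
move=> v0n Bv0 stab; have [V [VE Vf]] : exists V : 'M_(\rank (kermx B^T), n),
    (V :=: kermx B^T)%MS /\ row_free V.
  by exists (row_base (kermx B^T)); split; [exact: eq_row_base|exact: row_base_free].
have BVt : B *m V^T = 0.
  apply: trmx_inj; rewrite trmx_mul trmxK trmx0; apply/sub_kermxP.
  by rewrite VE.
have : (V *m A^T <= V)%MS.
  rewrite VE; apply/sub_kermxP; apply: trmx_inj.
  rewrite trmx0 !trmx_mul !trmxK; apply: eq_col => j; rewrite !mulmx_colE linear0.
  by apply: stab; rewrite -mulmx_colE BVt linear0.
(* [C] is the transposed matrix of [A] on the kernel of [B], whose basis is the rows of [V]. *)
case/submxP => C VA.
have r0 : (0 < \rank (kermx B^T))%N.
  rewrite lt0n mxrank_eq0; apply: contraNneq v0n => k0.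
  have : (v0^T <= kermx B^T)%MS by apply/sub_kermxP; rewrite -trmx_mul Bv0 trmx0.
  by rewrite k0 submx0 trmx_eq0.
have [a /eigenvalueP[u uC un]] := eigenvalue_closed C r0.
exists a, (u *m V)^T; split.
- rewrite trmx_eq0; apply: contraNneq un => uV.
  by have /row_freeP[W VW] := Vf; rewrite -[u]mulmx1 -VW mulmxA uV mul0mx.
- by rewrite trmx_mul mulmxA BVt mul0mx.
by rewrite -[A]trmxK -trmx_mul -mulmxA VA mulmxA uC -scalemxAl linearZ.
Qed.

Lemma closed_eigencol (F : numClosedFieldType) n (A : 'M[F]_n.+1) :
  exists a, exists2 v : 'cV_n.+1, v != 0 & A *m v = a *: v.
Proof.
have w0 : const_mx 1 != 0 :> 'cV[F]_n.+1.
  by apply/eqP => /colP/(_ ord0)/eqP; rewrite !mxE; exact/negP/oner_neq0.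
have [|v _|a [v [vn _ Av]]] := @stable_ker_eigencol _ _ A 0 _ w0.
- exact: mul0mx.
- exact: mul0mx.
by exists a, v.
Qed.

Lemma prod_sub_eigen (F : fieldType) n (z : 'M[F]_n.+1) (s : seq F) a (v : 'cV_n.+1) :
  z *m v = a *: v ->
  (\prod_(t <- s) (z - t%:M)) *m v = (\prod_(t <- s) (a - t)) *: v.
Proof.
move=> zv; elim: s => [|t s IH]; first by rewrite !big_nil mul1mx scale1r.
rewrite !big_cons -mulmxE -mulmxA IH -scalemxAr mulmxBl zv mul_scalar_mx -scalerBl.
by rewrite scalerA mulrC.
Qed.

Section Annihilated.
Variables (F : fieldType) (n : nat) (z : 'M[F]_n.+1) (s : seq F).
Hypothesis ann : \prod_(t <- s) (z - t%:M) = 0.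

Lemma ann_eigen a (v : 'cV_n.+1) : v != 0 -> z *m v = a *: v -> a \in s.
Proof.
move=> vn /(prod_sub_eigen s); rewrite ann mul0mx => /esym/eqP.
rewrite scaler_eq0 (negPf vn) orbF prodf_seq_eq0 => /hasP[t ts].
by rewrite /= subr_eq0 => /eqP ->.
Qed.

(** Let [u = (z - a) v]. The product without the factor at [a] kills [u], but acts on it by a scalar
    that is nonzero since the roots are distinct. *)
Lemma ann_semisimple a (v : 'cV_n.+1) : uniq s ->
  (z - a%:M) *m ((z - a%:M) *m v) = 0 -> (z - a%:M) *m v = 0.
Proof.
move=> us e; set u := _ *m v; have zu : z *m u = a *: u.
  by apply/eqP; rewrite -subr_eq0 -mul_scalar_mx -mulmxBl e.
have [//|un] := eqVneq u 0; have as' := ann_eigen un zu.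
have annr : \prod_(t <- rem a s) (z - t%:M) *m (z - a%:M) = 0.
  have hornerE r : \prod_(t <- r) (z - t%:M) = horner_mx z (\prod_(t <- r) ('X - t%:P)).
    rewrite rmorph_prod; apply: eq_bigr => t _.
    by rewrite rmorphB /= horner_mx_X horner_mx_C.
  have sE : \prod_(t <- s) ('X - t%:P) =
      \prod_(t <- rem a s) ('X - t%:P) * ('X - a%:P) :> {poly F}.
    by rewrite (perm_big _ (perm_to_rem as')) big_cons mulrC.
  move: ann; rewrite !hornerE sE rmorphM rmorphB /= horner_mx_X horner_mx_C.
  exact.
have := prod_sub_eigen (rem a s) zu; rewrite {1}/u mulmxA annr mul0mx.
move/esym/eqP; rewrite scaler_eq0 prodf_seq_eq0 => /orP[/hasP[t]|/eqP //].
by rewrite mem_rem_uniq // inE /= subr_eq0 => /andP[/negP ta _] /eqP /esym /eqP.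
Qed.

End Annihilated.

(** The indices [k] and [D - k] give the same square; [undup] makes the roots simple, as
    [ann_semisimple] requires. *)
Definition cube_spec (F : nzRingType) (D : nat) : seq F :=
  undup [seq (D%:R - 2%:R * k%:R) ^+ 2 | k <- iota 0 D.+1].

Lemma irr_tridiag_affine (F : fieldType) n (T Dg : 'M[F]_n) (a b c : F) :
  irr_tridiag T -> is_diag_mx Dg -> a != 0 -> irr_tridiag (a *: T + b *: Dg + c%:M).
Proof.
move=> tT dD an i j; have [h1 h2] := tT i j.
have off : (i : nat) != j -> (i == j) = false /\ Dg i j = 0.
  by move=> ne; split; [exact: negbTE | exact: (is_diag_mxP dD)].
split=> ij; have [|ne d0] := off; try lia; rewrite !mxE ne d0 mulr0 !addr0.
  by rewrite h1 ?mulr0.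
by rewrite mulf_neq0 ?h2.
Qed.

(** * The Racah relations in terms of [z] and [N] *)

Section Ladder.
Variables (F : numFieldType) (n : nat) (x y z N : 'M[F]_n) (k : F).
Hypothesis xE : x = 2%:R^-1 *: (k *: 1%:M - z) + N.
Hypothesis yE : y = 2%:R^-1 *: (k *: 1%:M - z) - N.

Let p := 2%:R^-1 *: (k *: 1%:M - z).

Let zE : z = k *: 1%:M - 2%:R *: p.
Proof. by rewrite /p; apply/matrixP => i j; rewrite !mxlinE; field. Qed.

(** [x] differs from [N] by a polynomial in [z], so both have the same double commutator with [z];
    on the right, [x - y = 2 N]. *)
Lemma racah_z_ladder : racah_rel z x y ->
  z *m z *m N - 2%:R *: (z *m N *m z) + N *m z *m z =
  32%:R *: (z *m N + N *m z) - 256%:R *: N.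
Proof.
rewrite /racah_rel xE yE => h; apply/matrixP => i j.
move: h; have -> : 2%:R^-1 *: (k *: 1%:M - z) + N - (2%:R^-1 *: (k *: 1%:M - z) - N)
  = 2%:R *: N by mxring.
rewrite !(mxexpand, mulmx1, mul1mx) => /matrixP/(_ i j); rewrite !mxlinE => h.
by apply: (eq_of_subr_eq h); field.
Qed.

(** Both [[x, y]] and [[y, z]] equal [-2 [p, N]]. In the difference of the two relations the outer
    commutator is thus with [x - y = 2 N], and only [[N, [p, N]]] survives on the left. *)
Lemma racah_N_ladder : racah_rel x y z -> racah_rel y z x ->
  2%:R *: (N *m z *m N) - N *m N *m z - z *m N *m N + 32%:R *: (N *m N) =
  24%:R *: (z *m z) + (192%:R - 32%:R * k) *: z
    + (8%:R * k ^+ 2 - 64%:R * k)%:M.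
Proof.
pose c := p *m N - N *m p.
have dbl (a b : 'M[F]_n) : a *m a *m b - 2%:R *: (a *m b *m a) + b *m a *m a =
    a *m (a *m b - b *m a) - (a *m b - b *m a) *m a by mxring.
have xy : x *m y - y *m x = - (2%:R *: c).
  by rewrite xE yE -/p /c; move: p => q; mxring.
have yz : y *m z - z *m y = - (2%:R *: c).
  rewrite yE -/p zE /c; move: p => q; apply/matrixP => i j.
  by rewrite !(mxexpand, mulmx1, mul1mx) !mxlinE; ring.
have yz' : y - z = 3%:R *: p - N - k *: 1%:M by rewrite yE -/p zE; mxring.
have zx' : z - x = k *: 1%:M - 3%:R *: p - N by rewrite xE -/p zE; mxring.
rewrite /racah_rel !dbl xy yz yz' zx' xE yE -/p zE => h1 h2.
rewrite -[X in _ = _ + X]scalemx1.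
move: h1 h2; rewrite /c; move: p => q.
rewrite !(mxexpand, mulmx1, mul1mx) => h1 h2; apply/matrixP => i j.
move/matrixP/(_ i j): h1; move/matrixP/(_ i j): h2; rewrite !mxlinE => h2 h1.
have h : forall a b c d : F, a = b -> c = d -> (a - c) / 2%:R = (b - d) / 2%:R.
  by move=> ? ? ? ? -> ->.
by apply: (eq_of_subr_eq (h _ _ _ _ h1 h2)); field.
Qed.

End Ladder.

(** * The bottom of the ladder in an irreducible module *)

Section RacahModule.
Variables (F : numClosedFieldType) (m D : nat) (x y z : 'M[F]_m.+1).
Hypothesis rxyz : racah_rel x y z.
Hypothesis ryzx : racah_rel y z x.
Hypothesis rzxy : racah_rel z x y.
Hypothesis ann : \prod_(t <- cube_spec F D) (z - t%:M) = 0.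
Hypothesis irr : forall U : 'M[F]_m.+1, (exists Y, x *m U = U *m Y) ->
  (exists Y, y *m U = U *m Y) -> (exists Y, z *m U = U *m Y) ->
  U = 0 \/ \rank U = m.+1.
Variables (kap : F) (N : 'M[F]_m.+1).
Hypothesis xE : x = 2%:R^-1 *: (kap *: 1%:M - z) + N.
Hypothesis yE : y = 2%:R^-1 *: (kap *: 1%:M - z) - N.

Lemma z_ladder : z *m z *m N - 2%:R *: (z *m N *m z) + N *m z *m z =
  32%:R *: (z *m N + N *m z) - 256%:R *: N.
Proof. exact: racah_z_ladder xE yE rzxy. Qed.

Lemma N_ladder : 2%:R *: (N *m z *m N) - N *m N *m z - z *m N *m N
  + 32%:R *: (N *m N) = 24%:R *: (z *m z) + (192%:R - 32%:R * kap) *: z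
    + (8%:R * kap ^+ 2 - 64%:R * kap)%:M.
Proof. exact: racah_N_ladder xE yE rxyz ryzx. Qed.

Lemma irr_zN (U : 'M[F]_m.+1) : (exists Y, z *m U = U *m Y) ->
  (exists Y, N *m U = U *m Y) -> U = 0 \/ \rank U = m.+1.
Proof.
move=> [Yz hz] [YN hN]; apply: irr; last by exists Yz.
  exists (2%:R^-1 *: (kap *: 1%:M - Yz) + YN); rewrite xE.
  by rewrite !(mulmxDl, mulmxDr, mulmxN, mulNmx, =^~ scalemxAl, =^~ scalemxAr,
    mul1mx, mulmx1) hz hN.
exists (2%:R^-1 *: (kap *: 1%:M - Yz) - YN); rewrite yE.
by rewrite !(mulmxDl, mulmxDr, mulmxN, mulNmx, =^~ scalemxAl, =^~ scalemxAr,
    mul1mx, mulmx1) hz hN.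
Qed.

(** An integer square root of an eigenvalue of [z], so [h] and [-h] are weights together. *)
Definition is_weight (h : int) : Prop :=
  exists2 v : 'cV[F]_m.+1, v != 0 & z *m v = (h%:~R ^+ 2) *: v.

Lemma is_weight_cube h : is_weight h ->
  exists2 k : nat, (k <= D)%N & h = D%:Z - 2%:Z * k%:Z \/ h = 2%:Z * k%:Z - D%:Z.
Proof.
case=> v vn /(ann_eigen ann vn); rewrite mem_undup => /mapP[k].
rewrite mem_iota add0n ltnS => /andP[_ kD] e; exists k => //.
have {}e : h ^+ 2 = (D%:Z - 2%:Z * k%:Z) ^+ 2.
  by apply: (@intr_inj F); rewrite !rmorphXn /= e rmorphB rmorphM /= !pmulrn.
move/eqP: e; rewrite eqf_sqr => /orP[/eqP ->|/eqP ->]; [by left|right].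
by rewrite opprB.
Qed.

Lemma some_weight : exists h, is_weight h.
Proof.
have [a [v vn zv]] := closed_eigencol z.
have := ann_eigen ann vn zv.
rewrite mem_undup => /mapP[k _ e]; exists (D%:Z - 2%:Z * k%:Z).
by exists v => //; rewrite zv e rmorphB rmorphM /= !pmulrn.
Qed.

(** On an eigenvector the ladder relation becomes a quadratic in [z] killing [N v], whose roots have
    sum [2 h^2 + 32] and product [(h^2 - 16)^2]. *)
Lemma z_ladder_eigen (h : F) (v : 'cV[F]_m.+1) : z *m v = (h ^+ 2) *: v ->
  (z - ((h - 4%:R) ^+ 2)%:M) *m ((z - ((h + 4%:R) ^+ 2)%:M) *m (N *m v)) = 0.
Proof.
move=> zv; have := congr1 (mulmx^~ v) z_ladder.
rewrite /= !(mulmxDl, mulNmx, =^~ scalemxAl) -!mulmxA zv -!scalemxAr zv -!scalemxAr.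
move=> e; rewrite !(mulmxDl, mulmxDr, mulNmx, mulmxN, mul_scalar_mx, =^~ scalemxAr).
apply/matrixP => i j; move/matrixP/(_ i j): e; rewrite !mxlinE => e.
by apply: (eq_of_subr_eq e); ring.
Qed.

(** Opposite nodes would give [2 h + 4 (j + k) = 0], impossible for odd [h]; for [h >= 0] it forces
    [j = k = 0]. *)
Lemma node_sqr_inj (h : int) : 0 <= h \/ odd `|h|%N ->
  injective (fun k => node (h%:~R : F) k ^+ 2).
Proof.
move=> hh j k; have nodeE i : node (h%:~R : F) i = (h + 4%:Z * i%:Z)%:~R.
  by rewrite /node rmorphD rmorphM /= !pmulrn.
rewrite !nodeE -!rmorphXn /= => /intr_inj/eqP; rewrite eqf_sqr.
by case/orP => /eqP; lia.
Qed.

Definition chain_start (t lam : F) (w0 w1 : 'cV[F]_m.+1) : Prop :=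
  [/\ w0 != 0, z *m w0 = (t ^+ 2) *: w0, N *m w0 = w1 + lam *: w0,
      z *m w1 = ((t + 4%:R) ^+ 2) *: w1 & lam * (t - 2%:R) = 0].

(** [(z - (h + 4)^2) N v] has eigenvalue [(h - 4)^2], so it vanishes when [h - 4] is no weight. *)
Lemma chain_start_lowest (h : int) : is_weight h -> ~ is_weight (h - 4%:Z) ->
  exists w0, chain_start h%:~R 0 w0 (N *m w0).
Proof.
move=> [v vn zv] low; exists v; split=> //; first by rewrite scale0r addr0.
  apply/eqP; rewrite -subr_eq0 -mul_scalar_mx -mulmxBl.
  apply: contra_notT low => un; eexists; first exact: un.
  apply/eqP; rewrite rmorphB /= -subr_eq0 -mul_scalar_mx -mulmxBl.
  by rewrite z_ladder_eigen.
by rewrite mul0r.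
Qed.

(** Both roots of the quadratic equal 16, and semisimplicity of [z] reduces the double factor to a
    simple one. *)
Lemma chain_start_zero : is_weight 0 -> exists w0, chain_start 0 0 w0 (N *m w0).
Proof.
move=> [v vn zv]; exists v; split=> //; first by rewrite scale0r addr0.
  apply/eqP; rewrite -subr_eq0 -mul_scalar_mx -mulmxBl; apply/eqP.
  apply: (ann_semisimple ann); first exact: undup_uniq.
  by have := z_ladder_eigen zv; rewrite sub0r sqrrN add0r.
by rewrite mul0r.
Qed.

(** Since [(2 - 4)^2 = 2^2], the operator [(z - 36) N] preserves the eigenspace of 4 and has an
    eigenvector [w] there. *)
Lemma chain_start_two : is_weight 2 ->
  exists w0, exists w1, exists lam, chain_start 2%:R lam w0 w1.
Proof.
move=> [v vn zv]; set b := (2%:R + 4%:R : F) ^+ 2.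
have b' : (2%:R - 4%:R : F) ^+ 2 = 2%:R ^+ 2 by ring.
have [||mu [w [wn Bw Aw]]] :=
  @stable_ker_eigencol _ _ ((z - b%:M) *m N) (z - (2%:R ^+ 2)%:M) v vn.
- by rewrite mulmxBl zv mul_scalar_mx subrr.
- move=> u Bu; rewrite -b' -!mulmxA; apply: z_ladder_eigen.
  by apply/eqP; rewrite -subr_eq0 -mul_scalar_mx -mulmxBl Bu.
have zw : z *m w = (2%:R ^+ 2) *: w.
  by apply/eqP; rewrite -subr_eq0 -mul_scalar_mx -mulmxBl Bw.
(* [z - 36] acts on [w] by [4 - 36 = -32], so subtracting [lam *: w] from [N w] leaves a vector
   killed by [z - 36]. *)
pose lam := - mu / 32%:R.
exists w, (N *m w - lam *: w), lam; split=> //; first by rewrite subrK.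
  move: Aw; rewrite -mulmxA mulmxBl mul_scalar_mx -/b => Aw.
  rewrite mulmxBr -scalemxAr zw /lam /b in Aw *.
  apply/matrixP => i j; move/matrixP/(_ i j): Aw; rewrite !mxlinE => Aw.
  by apply: (eq_of_subr_eq Aw); field.
by rewrite subrr mulr0.
Qed.

Lemma exists_chain_start : exists t lam w0 w1,
  chain_start t lam w0 w1 /\ injective (fun k => node t k ^+ 2).
Proof.
have [h0 wh0] := some_weight.
have [oD|eD] := boolP (odd D).
  have [h [wh oh low]] : exists h,
      [/\ is_weight h, odd `|h|%N & ~ is_weight (h - 4%:Z)].
    (* Otherwise one could descend by 4 forever; [D + 1] steps already leave the interval from [-D]
       to [D]. *)
    apply: contrapT => no.
    have desc n : is_weight (h0 - 4%:Z * n%:Z) /\ odd `|(h0 - 4%:Z * n%:Z)%R|%N.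
      elim: n => [|n [IH on]].
        rewrite mulr0 subr0; split=> //.
        by have [k kD] := is_weight_cube wh0; lia.
      split; last by lia.
      apply: contrapT => lo; apply: no; exists (h0 - 4%:Z * n%:Z); split=> //.
      by have <- : h0 - 4%:Z * n.+1%:Z = h0 - 4%:Z * n%:Z - 4%:Z by lia.
    have [k kD hk] := is_weight_cube wh0.
    have [/is_weight_cube[k' kD' hk'] _] := desc D.+1.
    by lia.
  have [w0 cs] := chain_start_lowest wh low.
  by exists h%:~R, 0, w0, (N *m w0); split=> //; apply: node_sqr_inj; right.
(* For even [D] all weights are even. Let [a] be the least nonnegative one: 0 and 2 are the folded
   cases, and for larger [a] the absolute value of [a - 4] is below [a], so [a - 4] is no weight. *)
have wabs h : is_weight h -> is_weight `|h|%N%:Z.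
  case: (ltrP h 0) => hs; last by rewrite gez0_abs.
  rewrite ltz0_abs // => -[v vn zv]; exists v => //.
  by rewrite zv rmorphN /= sqrrN.
have exw : exists n : nat, `[< is_weight n%:Z >] by exists `|h0|%N; apply/asboolP/wabs.
case: (ex_minnP exw) => a /asboolP wa amin.
have [k kD ka] := is_weight_cube wa.
have inj : injective (fun k => node (a%:Z%:~R : F) k ^+ 2) by apply: node_sqr_inj; left.
case: a wa amin ka inj => [|[|[|a]]] wa amin ka inj; try lia.
- have [w0 cs] := chain_start_zero wa.
  by exists 0, 0, w0, (N *m w0).
- have [w0 [w1 [lam cs]]] := chain_start_two wa.
  by exists 2%:R, lam, w0, w1.
have [|w0 cs] := chain_start_lowest wa.
  by move/wabs/asboolP/amin; lia.
by eexists _, 0, w0, (N *m w0); split; [exact: cs|].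
Qed.

Lemma racah_lt_cond : lt_cond z x y.
Proof.
have [t [lam [w0 [w1 [[w0n zw0 Nw0 zw1 lamt] inj]]]]] := exists_chain_start.
have [P [uP dP tP]] := chain_diag_trid N_ladder irr_zN inj w0n zw0 Nw0 zw1 lamt.
exists P; split=> //.
- rewrite xE.
  have -> : invmx P *m (2%:R^-1 *: (kap *: 1%:M - z) + N) *m P =
    1 *: (invmx P *m N *m P) + (- 2%:R^-1) *: (invmx P *m z *m P) + (kap / 2%:R)%:M.
    rewrite -[X in _ = _ + X]scalemx1; apply/matrixP => i j.
    by rewrite !(mxexpand, mulmx1, mulVmx uP) !mxlinE; field.
  by apply: irr_tridiag_affine; rewrite ?oner_neq0.
rewrite yE.
have -> : invmx P *m (2%:R^-1 *: (kap *: 1%:M - z) - N) *m P =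
  (-1) *: (invmx P *m N *m P) + (- 2%:R^-1) *: (invmx P *m z *m P) + (kap / 2%:R)%:M.
  rewrite -[X in _ = _ + X]scalemx1; apply/matrixP => i j.
  by rewrite !(mxexpand, mulmx1, mulVmx uP) !mxlinE; field.
by apply: irr_tridiag_affine; rewrite ?oppr_eq0 ?oner_neq0.
Qed.

End RacahModule.

(** * Schur's lemma for the central element [x + y + z] *)

Section SchurRacah.
Variables (F : numClosedFieldType) (m : nat) (x y z : 'M[F]_m.+1).
Hypothesis irr : forall U : 'M[F]_m.+1, (exists Y, x *m U = U *m Y) ->
  (exists Y, y *m U = U *m Y) -> (exists Y, z *m U = U *m Y) ->
  U = 0 \/ \rank U = m.+1.

Lemma schur_scalar (k : 'M[F]_m.+1) :
  comm_mx x k -> comm_mx y k -> comm_mx z k -> exists a, k = a%:M.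
Proof.
move=> xk yk zk; have [a [v vn kv]] := closed_eigencol k.
exists a; pose B := k - a%:M; pose U := (kermx B^T)^T.
have BU : B *m U = 0.
  by apply: trmx_inj; rewrite trmx_mul trmxK trmx0 mulmx_ker.
have stab g : comm_mx g k -> exists Y, g *m U = U *m Y.
  move=> gk; have : ((g *m U)^T <= kermx B^T)%MS.
    apply/sub_kermxP; rewrite -trmx_mul mulmxA.
    have -> : B *m g = g *m B by rewrite mulmxBl mulmxBr gk scalar_mxC.
    by rewrite -mulmxA BU mulmx0 trmx0.
  case/submxP => C e; exists C^T.
  by rewrite -[LHS]trmxK e trmx_mul.
have [U0|/eqP rU] := irr (stab _ xk) (stab _ yk) (stab _ zk).
  have : (v^T <= kermx B^T)%MS.
    by apply/sub_kermxP; rewrite -trmx_mul mulmxBl kv mul_scalar_mx subrr trmx0.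
  rewrite -[kermx _]trmxK -/U U0 trmx0 submx0 trmx_eq0.
  by rewrite (negPf vn).
have uU : U \in unitmx by rewrite -row_free_unit.
by apply/eqP; rewrite -subr_eq0 -/B -[B](mulmxK uU) BU mul0mx.
Qed.

Lemma racah_irr_lt_cond (D : nat) :
  racah_rel x y z -> racah_rel y z x -> racah_rel z x y ->
  comm_mx x (x + y + z) -> comm_mx y (x + y + z) -> comm_mx z (x + y + z) ->
  \prod_(t <- cube_spec F D) (z - t%:M) = 0 -> lt_cond z x y.
Proof.
move=> r1 r2 r3 c1 c2 c3 ann; have [kap kE] := schur_scalar c1 c2 c3.
have e : x + y + z = kap *: 1%:M by rewrite kE scalemx1.
apply: (racah_lt_cond r1 r2 r3 ann irr (kap := kap) (N := 2%:R^-1 *: (x - y)));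
  by rewrite -e; apply/matrixP => i j; rewrite !mxlinE; field.
Qed.

End SchurRacah.

Lemma lt_cond_affine (F : fieldType) n (a b : F) (X Y Z : 'M[F]_n) : a != 0 ->
  lt_cond X Y Z -> lt_cond (a *: X + b%:M) (a *: Y + b%:M) (a *: Z + b%:M).
Proof.
move=> an [P [uP dX tY tZ]]; exists P.
have conjE (A : 'M[F]_n) :
    invmx P *m (a *: A + b%:M) *m P = a *: (invmx P *m A *m P) + b%:M.
  rewrite mulmxDr mulmxDl -scalemxAr -scalemxAl; congr (_ + _).
  by rewrite mul_mx_scalar -scalemxAl mulVmx // scalemx1.
have tri (A : 'M[F]_n) : irr_tridiag A -> irr_tridiag (a *: A + b%:M).
  move=> tA; have := irr_tridiag_affine 0 b tA (mx0_is_diag _ _ _) an.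
  by rewrite scaler0 addr0.
split=> //; rewrite conjE; try exact: tri.
apply/is_diag_mxP => i j ij.
rewrite addmxE scalemxE (is_diag_mxP dX) // mulr0 add0r mxE.
by have -> : (i == j) = false by apply/negbTE.
Qed.

(** * The hypercube *)

Section SymDiff.
Variable T : finType.
Implicit Types r s t : {set T}.

Definition symdiff s t : {set T} := (s :\: t) :|: (t :\: s).

Lemma in_symdiff i s t : (i \in symdiff s t) = (i \in s) (+) (i \in t).
Proof. by rewrite !inE; case: (i \in s); case: (i \in t). Qed.

Lemma symdiffC s t : symdiff s t = symdiff t s.
Proof. by rewrite /symdiff setUC. Qed.

Lemma symdiffA r s t : symdiff r (symdiff s t) = symdiff (symdiff r s) t.
Proof. by apply/setP => i; rewrite !in_symdiff addbA. Qed.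

Lemma symdiffK s t : symdiff s (symdiff s t) = t.
Proof. by apply/setP => i; rewrite !in_symdiff addbA addbb. Qed.

Lemma symdiff_bij s : bijective (symdiff s).
Proof. by exists (symdiff s) => t; rewrite symdiffK. Qed.

(** Parametrization by the two differences and the intersection: a fixed distance [a + b] leaves
    finitely many cases. *)
Lemma card_symdiff s t : exists a b c,
  [/\ #|symdiff s t| = a + b, #|s| = c + a & #|t| = c + b]%N.
Proof.
exists #|s :\: t|, #|t :\: s|, #|s :&: t|; split.
- rewrite /symdiff cardsU (_ : _ :&: _ = set0) ?cards0 ?subn0 //.
  by apply/setP => i; rewrite !inE; case: (i \in s); case: (i \in t).
- by rewrite cardsID.
by rewrite setIC cardsID.
Qed.

Lemma symdiff_eq0 s t : (#|symdiff s t| == 0%N) = (s == t).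
Proof.
rewrite cards_eq0; apply/eqP/eqP => [e|->].
  by apply/setP => i; have /setP/(_ i) := e; rewrite in_symdiff inE; do 2 case: (i \in _).
by apply/setP => i; rewrite in_symdiff addbb inE.
Qed.

Lemma card_symdiff1 s k :
  #|symdiff s [set k]| = if k \in s then #|s|.-1 else #|s|.+1.
Proof.
case: ifP => ks.
  rewrite (cardsD1 k s) ks add1n /=; congr #|pred_of_set _|; apply/setP => i.
  by rewrite in_symdiff !inE; case: eqP => [->|_]; rewrite ?ks ?addbF.
have <- : #|k |: s| = #|s|.+1 by rewrite cardsU1 ks.
congr #|pred_of_set _|; apply/setP => i.
by rewrite in_symdiff !inE; case: eqP => [->|_]; rewrite ?ks ?addbF.
Qed.

End SymDiff.

Lemma card_powerset_prednK D : (Xn D).+1 = #|{set 'I_D}|.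
Proof. by rewrite /Xn prednK //; apply/card_gt0P; exists set0. Qed.

Lemma pt_inj D : injective (@pt D).
Proof.
move=> i j /eqP; rewrite nth_uniq ?enum_uniq -?cardE -?card_powerset_prednK //.
by move=> /eqP/val_inj.
Qed.

Lemma sum_pt (R : nmodType) D (f : {set 'I_D} -> R) :
  \sum_(i < (Xn D).+1) f (pt i) = \sum_s f s.
Proof.
have -> : \sum_s f s = \sum_(s <- enum {set 'I_D}) f s by rewrite big_enum.
by rewrite (big_nth set0) big_mkord -cardE -card_powerset_prednK.
Qed.

(** * The so(3) triple of the hypercube *)

Section CubeMatrices.
Variables (F : numClosedFieldType) (D : nat).
Implicit Types s t u : {set 'I_D}.
Implicit Types f g : {set 'I_D} -> {set 'I_D} -> F.

Definition cmx f : 'M[F]_((Xn D).+1) := \matrix_(i, j) f (pt i) (pt j).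

Lemma eq_cmx f g : (forall s t, f s t = g s t) -> cmx f = cmx g.
Proof. by move=> fg; apply/matrixP => i j; rewrite !mxE fg. Qed.

Lemma cmxM f g : cmx f *m cmx g = cmx (fun s t => \sum_u f s u * g u t).
Proof.
apply/matrixP => i j; rewrite !mxE -(sum_pt (fun u => f (pt i) u * g u (pt j))).
by apply: eq_bigr => k _; rewrite !mxE.
Qed.

Lemma cmxD f g : cmx f + cmx g = cmx (fun s t => f s t + g s t).
Proof. by apply/matrixP => i j; rewrite !mxE. Qed.

Lemma cmxN f : - cmx f = cmx (fun s t => - f s t).
Proof. by apply/matrixP => i j; rewrite !mxE. Qed.

Lemma cmxZ a f : a *: cmx f = cmx (fun s t => a * f s t).
Proof. by apply/matrixP => i j; rewrite !mxE. Qed.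

Definition cdiag (d : {set 'I_D} -> F) := cmx (fun s t => (s == t)%:R * d t).

Lemma scalar_cdiag a : a%:M = cdiag (fun=> a).
Proof. by apply/matrixP => i j; rewrite !mxE (inj_eq (@pt_inj D)) mulr_natl. Qed.

Lemma cdiagMl d f : cdiag d *m cmx f = cmx (fun s t => d s * f s t).
Proof.
rewrite cmxM; apply: eq_cmx => s t; rewrite (bigD1 s) //= eqxx mul1r big1 ?addr0 //.
by move=> u /negPf us; rewrite eq_sym us !mul0r.
Qed.

Lemma cdiagMr d f : cmx f *m cdiag d = cmx (fun s t => f s t * d t).
Proof.
rewrite cmxM; apply: eq_cmx => s t; rewrite (bigD1 t) //= eqxx mul1r big1 ?addr0 //.
by move=> u /negPf us; rewrite us mul0r mulr0.
Qed.

Lemma cdiagM d e : cdiag d *m cdiag e = cdiag (fun s => d s * e s).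
Proof.
rewrite (cdiagMl d (fun s t => (s == t)%:R * e t)); apply: eq_cmx => s t.
by have [->|_] := eqVneq s t; rewrite ?mul1r // !mul0r mulr0.
Qed.

Definition wt s : F := D%:R - 2%:R * #|s|%:R.
Definition adj : 'M[F]_((Xn D).+1) := cmx (fun s t => (#|symdiff s t| == 1)%N%:R).
Definition wtmx := cdiag wt.
(** The character [(-1)^|s :&: t|] of the group of subsets under symmetric difference. *)
Definition walsh_coef s t : F := \prod_i (if (i \in s) && (i \in t) then -1 else 1).
Definition walsh := cmx walsh_coef.
Definition phase := cdiag (fun s => 'i ^+ #|s|).
Definition adjY := ('i / 2%:R) *: (wtmx *m adj - adj *m wtmx).

Lemma sum_card1 s (g : {set 'I_D} -> F) :
  \sum_u (#|symdiff s u| == 1)%N%:R * g u = \sum_k g (symdiff s [set k]).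
Proof.
have card1E u : (#|symdiff s u| == 1)%N%:R = \sum_k (u == symdiff s [set k])%:R :> F.
  have symE k : (u == symdiff s [set k]) = (symdiff s u == [set k]).
    by apply/eqP/eqP => [->|<-]; rewrite symdiffK.
  under eq_bigr do rewrite symE.
  case: (boolP (#|symdiff s u| == 1)%N) => [/cards1P[k ->]|n1].
    rewrite (bigD1 k) //= eqxx big1 ?addr0 // => l lk.
    by rewrite (inj_eq set1_inj) eq_sym (negPf lk).
  by rewrite big1 // => k _; case: eqP => // e; rewrite e cards1 eqxx in n1.
under eq_bigr do rewrite card1E mulr_suml.
rewrite exchange_big; apply: eq_bigr => k _ /=.
rewrite (bigD1 (symdiff s [set k])) //= eqxx mul1r big1 ?addr0 // => u /negPf ->.
by rewrite mul0r.
Qed.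

Lemma sum_in (t : {set 'I_D}) : \sum_(k < D) (k \in t)%:R = #|t|%:R :> F.
Proof. by rewrite -natr_sum -sum1_card [in RHS]big_mkcond. Qed.

Lemma walsh_symdiff r s t :
  walsh_coef (symdiff r s) t = walsh_coef r t * walsh_coef s t.
Proof.
rewrite /walsh_coef -big_split; apply: eq_bigr => i _ /=; rewrite in_symdiff.
by do 3 case: (i \in _); rewrite /= ?mulr1 ?mul1r // mulrNN mulr1.
Qed.

Lemma walshC s t : walsh_coef s t = walsh_coef t s.
Proof. by apply: eq_bigr => i _; rewrite andbC. Qed.

Lemma walsh1 k t : walsh_coef [set k] t = 1 - 2%:R * (k \in t)%:R.
Proof.
rewrite /walsh_coef (bigD1 k) //= inE eqxx big1 => [|i ik].
  by case: (k \in t); rewrite /=; ring.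
by rewrite inE (negPf ik).
Qed.

(** Column [t] is a character, hence an eigenvector with eigenvalue the sum of its values at
    singletons, [D - 2|t|]. *)
Lemma adj_walsh : adj *m walsh = walsh *m wtmx.
Proof.
rewrite cdiagMr cmxM; apply: eq_cmx => s t.
rewrite (sum_card1 s (walsh_coef^~ t)).
under eq_bigr do rewrite walsh_symdiff walsh1.
by rewrite -mulr_sumr sumrB -mulr_sumr sum_in sumr_const card_ord.
Qed.

Lemma wtmx_walsh : wtmx *m walsh = walsh *m adj.
Proof.
have sym f : (forall s t, f s t = f t s) -> (cmx f)^T = cmx f.
  by move=> fC; apply/matrixP => i j; rewrite !mxE.
have adjT : adj^T = adj by apply: sym => s t; rewrite symdiffC.
have wtT : wtmx^T = wtmx.
  by apply: sym => s t; rewrite eq_sym; case: eqP => [->|_]; rewrite ?mul0r.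
by apply: trmx_inj; rewrite !trmx_mul adjT wtT (sym _ walshC) adj_walsh.
Qed.

(** For [k] in [r], translation by [[set k]] changes the sign of every term. *)
Lemma walsh_sum r : \sum_u walsh_coef r u = if r == set0 then #|{set 'I_D}|%:R else 0.
Proof.
case: eqP => [->|/eqP/set0Pn[k kr]].
  rewrite -sumr_const; apply: eq_bigr => u _.
  by rewrite /walsh_coef big1 // => i _; rewrite inE.
have bij := symdiff_bij [set k].
have e : \sum_u walsh_coef r u = - \sum_u walsh_coef r u.
  rewrite {1}(reindex (symdiff [set k])) /=; last exact: onW_bij.
  rewrite -sumrN; apply: eq_bigr => u _.
  by rewrite walshC walsh_symdiff walsh1 kr [walsh_coef u r]walshC /=; ring.
by apply/eqP; rewrite -[_ == 0](mulrn_eq0 _ 2) mulr2n {1}e addNr.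
Qed.

Lemma walsh_unit : walsh \in unitmx.
Proof.
have e : walsh *m walsh = (#|{set 'I_D}|%:R)%:M.
  rewrite scalar_cdiag cmxM; apply: eq_cmx => s t.
  under eq_bigr do rewrite [walsh_coef _ t]walshC -walsh_symdiff.
  rewrite walsh_sum -cards_eq0 symdiff_eq0.
  by case: eqP; rewrite ?mul1r ?mul0r.
have n0 : #|{set 'I_D}|%:R != 0 :> F by rewrite pnatr_eq0 -card_powerset_prednK.
have : walsh *m ((#|{set 'I_D}|%:R)^-1 *: walsh) = 1%:M.
  by rewrite -scalemxAr e scale_scalar_mx mulVf.
by case/mulmx1_unit.
Qed.

(** The double commutator multiplies entry [(s, t)] by [(wt s - wt t)^2], which is 4 for adjacent
    vertices. *)
Lemma wtmx_dbl_adj : wtmx *m (wtmx *m adj) - 2%:R *: (wtmx *m adj *m wtmx)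
  + adj *m wtmx *m wtmx = 4%:R *: adj.
Proof.
rewrite /adj !(cdiagMl, cdiagMr, cmxZ, cmxN, cmxD); apply: eq_cmx => s t.
case: (#|symdiff s t| =P 1%N) => [e|_] /=; last by ring.
have [a [b [c [eab es et]]]] := card_symdiff s t.
have : (a = 0 /\ b = 1)%N \/ (a = 1 /\ b = 0)%N by lia.
by rewrite /wt es et => -[] [-> ->]; rewrite !natrD; ring.
Qed.

(** Conjugation by [walsh] exchanges [adj] and [wtmx]. *)
Lemma adj_dbl_wtmx : adj *m (adj *m wtmx) - 2%:R *: (adj *m wtmx *m adj)
  + wtmx *m adj *m adj = 4%:R *: wtmx.
Proof.
apply: (can_inj (mulmxK walsh_unit)).
have adjW (B : 'M[F]_((Xn D).+1)) : adj *m (walsh *m B) = walsh *m (wtmx *m B).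
  by rewrite !mulmxA adj_walsh.
have wtW (B : 'M[F]_((Xn D).+1)) : wtmx *m (walsh *m B) = walsh *m (adj *m B).
  by rewrite !mulmxA wtmx_walsh.
rewrite !(mulmxDl, mulNmx, =^~ scalemxAl) -!mulmxA !(wtmx_walsh, adj_walsh, adjW, wtW).
by rewrite (scalemxAr 4%:R) -wtmx_dbl_adj !mulmxDr mulmxN -scalemxAr !mulmxA.
Qed.

(** Walks of length two: two between vertices at distance 2, and [D] from a vertex back to
    itself. *)
Lemma adjE : 2%:R *: (A2J F D + A2Jbar F D) + D%:R%:M = adj *m adj.
Proof.
rewrite scalar_cdiag (_ : A2J F D + A2Jbar F D =
  cmx (fun s t => (#|symdiff s t| == 2)%N%:R)).
  rewrite cmxZ cmxD cmxM; apply: eq_cmx => s t.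
  rewrite sum_card1 -symdiff_eq0.
  have E k : (#|symdiff (symdiff s [set k]) t| == 1)%N%:R =
     (#|symdiff s t| == 2)%N%:R * (k \in symdiff s t)%:R +
     (#|symdiff s t| == 0)%N%:R * (1 - (k \in symdiff s t)%:R) :> F.
    rewrite -symdiffA [symdiff [set k] t]symdiffC symdiffA card_symdiff1.
    case: ifP => [kr|_]; last by rewrite eqSS /=; ring.
    have : (0 < #|symdiff s t|)%N by apply/card_gt0P; exists k.
    by case: #|_| => // q _; rewrite /=; ring.
  under [RHS]eq_bigr do rewrite E.
  rewrite big_split -!mulr_sumr sumrB sum_in sumr_const card_ord /=.
  by case: #|_| => [|[|[|q]]] /=; ring.
apply/matrixP => i j; rewrite !mxE /dist2 -/(symdiff _ _).
by case: eqP => _ /=; [case: eqP|]; rewrite /= ?addr0 ?add0r.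
Qed.

Lemma wtmxE : 2%:R *: A2star F D + D%:R%:M = wtmx *m wtmx.
Proof.
rewrite cdiagM scalar_cdiag; apply/matrixP => i j.
rewrite !mxE (inj_eq (@pt_inj D)) /wt.
by field.
Qed.

Lemma phase_unit : phase \in unitmx.
Proof.
have : phase *m cdiag (fun s => (- 'i) ^+ #|s|) = 1%:M.
  rewrite cdiagM scalar_cdiag; apply: eq_cmx => s t; congr (_ * _).
  by rewrite -exprMn mulrN -expr2 sqrCi opprK expr1n.
by case/mulmx1_unit.
Qed.

(** For adjacent vertices the entry of [adjY] is [-i] if [|s| = |t| + 1] and [i] if [|s| = |t| - 1];
    times [i^|t|] it is [-i^|s|] in both cases. *)
Lemma adjY_phase : adjY *m phase = - (phase *m adj).
Proof.
rewrite /adjY /phase /adj !(cdiagMl, cdiagMr, cmxZ, cmxN, cmxD); apply: eq_cmx => s t.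
have i2 : 'i * 'i = -1 :> F by rewrite -expr2 sqrCi.
case: (#|symdiff s t| =P 1%N) => [e|_] /=; last by ring.
have [a [b [c [eab es et]]]] := card_symdiff s t.
have : (a = 0 /\ b = 1)%N \/ (a = 1 /\ b = 0)%N by lia.
rewrite /wt es et => -[] [-> ->]; rewrite !natrD ?addn0 ?addn1 ?exprS.
  transitivity ('i * 'i * 'i ^+ c : F); first by field.
  by rewrite i2; ring.
by field.
Qed.

(** At distance 2 the cardinalities agree or differ by 2, so the ratio of phases is 1 on [A2J] and
    -1 on [A2Jbar]. *)
Lemma phase_conj : (2%:R *: (A2J F D - A2Jbar F D) + D%:R%:M) *m phase =
  phase *m (2%:R *: (A2J F D + A2Jbar F D) + D%:R%:M).
Proof.
have i2 : 'i * 'i = -1 :> F by rewrite -expr2 sqrCi.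
have -> : A2J F D =
  cmx (fun s t => ((#|symdiff s t| == 2) && (#|s| == #|t|))%N%:R) by [].
have -> : A2Jbar F D =
  cmx (fun s t => ((#|symdiff s t| == 2) && (#|s| != #|t|))%N%:R) by [].
have -> : D%:R%:M = cmx (fun s t => (s == t)%:R * D%:R) by exact: scalar_cdiag.
rewrite /phase.
rewrite !(cmxZ, cmxN, cmxD, cdiagMl, cdiagMr); apply: eq_cmx => s t.
have [->|ne] := eqVneq s t; first by rewrite eqxx andbF /=; ring.
case: (#|symdiff s t| =P 2%N) => [e|_] /=; last by ring.
have [a [b [c [eab es et]]]] := card_symdiff s t.
have : [\/ (a = 1 /\ b = 1)%N, (a = 2 /\ b = 0)%N | (a = 0 /\ b = 2)%N].
  have : (a = 1 /\ b = 1)%N \/ (a = 2 /\ b = 0)%N \/ (a = 0 /\ b = 2)%N by lia.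
  by move=> [|[|]] h; [apply: Or31|apply: Or32|apply: Or33].
rewrite es et eqn_add2l => -[] [-> ->] /=; rewrite ?addn0 ?addn2 ?addn1 ?exprS.
- by ring.
- by ring: i2.
by ring: i2.
Qed.

Lemma adjYE : 2%:R *: (A2J F D - A2Jbar F D) + D%:R%:M = adjY *m adjY.
Proof.
apply: (can_inj (mulmxK phase_unit)).
rewrite phase_conj adjE -[RHS]mulmxA adjY_phase mulmxN.
by rewrite [in RHS]mulmxA adjY_phase mulNmx opprK mulmxA.
Qed.

(** The sign makes [2 w * ('i / 2) = 1], which fits the definition of [adjY]. *)
Local Notation w := (- 'i : F).

Lemma so3_HX : wtmx *m adj - adj *m wtmx = (2%:R * w) *: adjY.
Proof.
rewrite /adjY scalerA (_ : _ * _ = 1) ?scale1r //.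
transitivity (- ('i ^+ 2) : F); first by field.
by rewrite sqrCi opprK.
Qed.

Lemma so3_YH : adjY *m wtmx - wtmx *m adjY = (2%:R * w) *: adj.
Proof.
have -> : (2%:R * w) *: adj = (- ('i / 2%:R)) *: (4%:R *: adj).
  by rewrite scalerA; congr (_ *: _); field.
rewrite -wtmx_dbl_adj /adjY; apply/matrixP => i j.
by rewrite !mxexpand !mxlinE; ring.
Qed.

Lemma so3_XY : adj *m adjY - adjY *m adj = (2%:R * w) *: wtmx.
Proof.
have -> : (2%:R * w) *: wtmx = (- ('i / 2%:R)) *: (4%:R *: wtmx).
  by rewrite scalerA; congr (_ *: _); field.
rewrite -adj_dbl_wtmx /adjY; apply/matrixP => i j.
by rewrite !mxexpand !mxlinE; ring.
Qed.

Lemma prod_conj n (x z P : 'M[F]_n.+1) (s : seq F) : P \in unitmx ->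
  x *m P = P *m z -> \prod_(t <- s) (z - t%:M) = 0 -> \prod_(t <- s) (x - t%:M) = 0.
Proof.
move=> uP xP z0; apply: (can_inj (mulmxK uP)); rewrite mul0mx.
suff -> : \prod_(t <- s) (x - t%:M) *m P = P *m \prod_(t <- s) (z - t%:M).
  by rewrite z0 mulmx0.
elim: s {z0} => [|t s IH]; first by rewrite !big_nil mul1mx mulmx1.
rewrite !big_cons -!mulmxE -mulmxA IH mulmxA mulmxBl xP -scalar_mxC -mulmxBr.
by rewrite mulmxA.
Qed.

Lemma ann_wtmx : \prod_(t <- cube_spec F D) (wtmx *m wtmx - t%:M) = 0.
Proof.
have E l : \prod_(t <- l) (wtmx *m wtmx - t%:M) =
    cdiag (fun u => \prod_(t <- l) (wt u ^+ 2 - t)).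
  elim: l => [|t l IH].
    rewrite big_nil -[1]/(1%:M) scalar_cdiag.
    by apply: eq_cmx => ? ?; rewrite big_nil.
  have subE : wtmx *m wtmx - t%:M = cdiag (fun u => wt u ^+ 2 - t).
    rewrite cdiagM scalar_cdiag /cdiag cmxN cmxD.
    by apply: eq_cmx => ? ?; ring.
  rewrite big_cons IH subE -mulmxE cdiagM.
  by apply: eq_cmx => ? ?; rewrite big_cons.
rewrite E; apply/matrixP => i j; rewrite !mxE; apply/eqP; rewrite mulf_eq0.
apply/orP; right; rewrite prodf_seq_eq0; apply/hasP; exists (wt (pt j) ^+ 2).
  rewrite mem_undup; apply/mapP; exists #|pt j| => //.
  by rewrite mem_iota add0n ltnS /= (leq_trans (max_card _)) ?card_ord.
by rewrite /= subrr.
Qed.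

Lemma ann_adj : \prod_(t <- cube_spec F D) (adj *m adj - t%:M) = 0.
Proof.
apply: (prod_conj walsh_unit) ann_wtmx.
by rewrite -mulmxA adj_walsh !mulmxA adj_walsh.
Qed.

Lemma ann_adjY : \prod_(t <- cube_spec F D) (adjY *m adjY - t%:M) = 0.
Proof.
by apply: (prod_conj phase_unit) ann_adj; rewrite -adjYE phase_conj adjE.
Qed.

End CubeMatrices.

(** * The homomorphism onto the generated algebra *)

Section GeneratedAlgebra.
Variables (F : fieldType) (n : nat) (g1 g2 g3 : 'M[F]_n.+1).

Lemma gen_algN (M : 'M[F]_n.+1) : gen_alg g1 g2 g3 M -> gen_alg g1 g2 g3 (- M).
Proof. by rewrite -scaleN1r; apply: ga_scale. Qed.

Lemma gen_alg_scalar (a : F) : gen_alg g1 g2 g3 a%:M.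
Proof. by rewrite -scalemx1; apply/ga_scale/ga_one. Qed.

Definition gen_pred : {pred 'M[F]_n.+1} := fun M => `[< gen_alg g1 g2 g3 M >].

Lemma gen_predP M : reflect (gen_alg g1 g2 g3 M) (M \in gen_pred).
Proof. exact: asboolP. Qed.

Lemma gen_pred_closed : GRing.subsemialg_closed gen_pred.
Proof.
split; first exact/gen_predP/ga_one.
- split=> [|M N /gen_predP hM /gen_predP hN].
    by rewrite -(scale0r 1%:M); apply/gen_predP/ga_scale/ga_one.
  exact/gen_predP/ga_add.
- by move=> a M /gen_predP hM; apply/gen_predP/ga_scale.
by move=> M N /gen_predP hM /gen_predP hN; apply/gen_predP/ga_mul.
Qed.

HB.instance Definition _ :=
  GRing.isSubalgClosed.Build F 'M[F]_n.+1 gen_pred gen_pred_closed.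

(** The generated algebra as an [algType], so that it can be a target of the universal property. *)
Record gen_type := GenType { gen_val :> 'M[F]_n.+1; gen_valP : gen_val \in gen_pred }.

HB.instance Definition _ := [isSub for gen_val].
HB.instance Definition _ := [Choice of gen_type by <:].
HB.instance Definition _ := [SubChoice_isSubAlgebra of gen_type by <:].

End GeneratedAlgebra.

(** * From the Racah relations to those of Re *)

Section RacahToRe.
Variables (F : numFieldType) (n : nat).
Implicit Types x y z : 'M[F]_n.+1.

Definition re_gen x : 'M[F]_n.+1 := 16%:R^-1 *: x - 4%:R^-1 *: 1%:M.

(** As [x] commutes with [y + z], exchanging [y] and [z] changes the sign of the double commutator,
    as it does on the right. *)
Lemma racah_rel_swap x y z : comm_mx x (x + y + z) -> racah_rel x y z ->
  racah_rel x z y.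
Proof.
rewrite /comm_mx /racah_rel !mxexpand => c r; apply/matrixP => i j.
have c1 := congr1 (mulmx x) c; have c2 := congr1 (mulmx^~ x) c.
rewrite /= !mxexpand in c1 c2.
move/matrixP/(_ i j): c1; move/matrixP/(_ i j): c2; move/matrixP/(_ i j): r.
rewrite !mxlinE => r c2 c1.
have h : forall a b a' b' a'' b'' : F, a = b -> a' = b' -> a'' = b'' ->
  - a + a' - a'' = - b + b' - b'' by move=> ? ? ? ? ? ? -> -> ->.
by apply: (eq_of_subr_eq (h _ _ _ _ _ _ r c1 c2)); ring.
Qed.

Lemma re_gen_affine x (k : F) :
  (k / 16%:R - 4%:R^-1)%:M + 8%:R^-1 *: x = re_gen (2%:R *: x + k%:M).
Proof.
rewrite /re_gen -[(_ - _)%:M]scalemx1 -[k%:M]scalemx1.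
by apply/matrixP => i j; rewrite !mxlinE; field.
Qed.

Lemma re_gen_lie x y : re_gen x *m re_gen y - re_gen y *m re_gen x =
  256%:R^-1 *: (x *m y - y *m x).
Proof.
rewrite /re_gen !(mxexpand, mulmx1, mul1mx).
by apply/matrixP => i j; rewrite !mxlinE; field.
Qed.

(** [[a, d] = [x, [x, y]] / 8192]. After the Racah relation the linear terms cancel and [[x, y + z]
    / 512] remains, which is zero by centrality. *)
Lemma racah_Re_alpha x y z : racah_rel x y z -> comm_mx x (x + y + z) ->
  let a := re_gen x in let b := re_gen y in let c := re_gen z in
  let d := 2%:R^-1 *: (a *m b - b *m a) in
  (a *m d - d *m a) + a *m c - b *m a = 0.
Proof.
rewrite /racah_rel /comm_mx /= re_gen_lie /re_gen.
rewrite !(mxexpand, mulmx1, mul1mx) => h1 h2; apply/matrixP => i j.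
move/matrixP/(_ i j): h1; move/matrixP/(_ i j): h2; rewrite !mxlinE => h2 h1.
have h : forall a b c d : F, a = b -> c = d ->
    8192%:R^-1 * a + 512%:R^-1 * c = 8192%:R^-1 * b + 512%:R^-1 * d.
  by move=> ? ? ? ? -> ->.
by apply: (eq_of_subr_eq (h _ _ _ _ h1 h2)); field.
Qed.

Lemma re_gen_comm x y z : comm_mx y (x + y + z) ->
  re_gen x *m re_gen y - re_gen y *m re_gen x =
  re_gen y *m re_gen z - re_gen z *m re_gen y.
Proof.
rewrite /comm_mx !re_gen_lie !mxexpand => h; congr (_ *: _); apply/matrixP => i j.
move/matrixP/(_ i j): h; rewrite !mxlinE => h.
by apply: (eq_of_subr_eq (esym h)); ring.
Qed.

End RacahToRe.

(** * The relations for the hypercube matrices *)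

Section CubeAlgebra.
Variables (F : numClosedFieldType) (D : nat).

Definition cube_x : 'M[F]_((Xn D).+1) := 2%:R *: (A2J F D + A2Jbar F D) + D%:R%:M.
Definition cube_y : 'M[F]_((Xn D).+1) := 2%:R *: (A2J F D - A2Jbar F D) + D%:R%:M.
Definition cube_z : 'M[F]_((Xn D).+1) := 2%:R *: A2star F D + D%:R%:M.

Let w2 : (- 'i : F) ^+ 2 = -1. Proof. by rewrite sqrrN sqrCi. Qed.

Lemma cube_racah :
  [/\ racah_rel cube_x cube_y cube_z, racah_rel cube_y cube_z cube_x &
      racah_rel cube_z cube_x cube_y].
Proof.
rewrite /cube_x /cube_y /cube_z adjE adjYE wtmxE.
by split; [apply: (so3_racah_rel w2 (so3_XY F D) (so3_HX F D))
          |apply: (so3_racah_rel w2 (so3_YH F D) (so3_XY F D))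
          |apply: (so3_racah_rel w2 (so3_HX F D) (so3_YH F D))].
Qed.

Lemma cube_central :
  [/\ comm_mx cube_x (cube_x + cube_y + cube_z),
      comm_mx cube_y (cube_x + cube_y + cube_z) &
      comm_mx cube_z (cube_x + cube_y + cube_z)].
Proof.
rewrite /cube_x /cube_y /cube_z adjE adjYE wtmxE; split.
- exact: (so3_casimir_comm (so3_XY F D) (so3_HX F D)).
- rewrite -addrA addrC; exact: (so3_casimir_comm (so3_YH F D) (so3_XY F D)).
rewrite addrC addrA; exact: (so3_casimir_comm (so3_HX F D) (so3_YH F D)).
Qed.

Lemma cube_ann : [/\ \prod_(t <- cube_spec F D) (cube_x - t%:M) = 0,
  \prod_(t <- cube_spec F D) (cube_y - t%:M) = 0 &
  \prod_(t <- cube_spec F D) (cube_z - t%:M) = 0].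
Proof.
rewrite /cube_x /cube_y /cube_z adjE adjYE wtmxE.
by split; [exact: ann_adj | exact: ann_adjY | exact: ann_wtmx].
Qed.

Lemma inR_cube : [/\ inR cube_x, inR cube_y & inR cube_z].
Proof.
have J : inR (A2J F D) by apply: ga_g1.
have Jb : inR (A2Jbar F D) by apply: ga_g2.
have S : inR (A2star F D) by apply: ga_g3.
by split; apply: ga_add (gen_alg_scalar _ _ _ _); apply: ga_scale => //;
  apply: ga_add => //; apply: gen_algN.
Qed.

Lemma imgAE : imgA F D = re_gen cube_x. Proof. exact: re_gen_affine. Qed.
Lemma imgBE : imgB F D = re_gen cube_z. Proof. exact: re_gen_affine. Qed.
Lemma imgCE : imgC F D = re_gen cube_y. Proof. exact: re_gen_affine. Qed.

End CubeAlgebra.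
Section CubeRacah.
Variables (F : numClosedFieldType) (D : nat).

Lemma Re_rel_of_eq0 (S : algType F) (a b c d : S) :
  comm a b = 2%:R * d -> comm b c = 2%:R * d -> comm c a = 2%:R * d ->
  comm a d + a * c - b * a = 0 -> comm b d + b * a - c * b = 0 ->
  comm c d + c * b - a * c = 0 -> Re_rel a b c d.
Proof.
move=> ab bc ca e1 e2 e3; split=> // e g.
by rewrite e1 e2 e3 !inE !orbb => /eqP -> _; rewrite mul0r mulr0.
Qed.

Definition imgD : 'M[F]_((Xn D).+1) :=
  2%:R^-1 *: (imgA F D *m imgB F D - imgB F D *m imgA F D).

Lemma imgABC_lie :
  imgB F D *m imgC F D - imgC F D *m imgB F D =
    imgA F D *m imgB F D - imgB F D *m imgA F D
  /\ imgC F D *m imgA F D - imgA F D *m imgC F D =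
     imgA F D *m imgB F D - imgB F D *m imgA F D.
Proof.
have [cx cy cz] := cube_central F D; rewrite imgAE imgBE imgCE.
have xzy : comm_mx (cube_z F D) (cube_x F D + cube_z F D + cube_y F D).
  by rewrite addrAC.
have zyx : comm_mx (cube_y F D) (cube_z F D + cube_y F D + cube_x F D).
  by rewrite [_ + cube_x F D]addrC addrA addrAC.
by rewrite (re_gen_comm xzy) (re_gen_comm zyx).
Qed.

(** [A], [B], [C] correspond to [x], [z], [y], the reverse of the cyclic order in [cube_racah];
    [racah_rel_swap] makes up for it. *)
Lemma img_Re_rel : Re_rel (imgA F D) (imgB F D) (imgC F D) imgD.
Proof.
have [l1 l2] := imgABC_lie.
have two_d : 2%:R * imgD = imgA F D *m imgB F D - imgB F D *m imgA F D.
  by rewrite mulr_natl /imgD -scaler_nat scalerA divff ?scale1r // pnatr_eq0.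
have [r1 r2 r3] := cube_racah F D; have [c1 c2 c3] := cube_central F D.
set x := cube_x F D in r1 r2 r3 c1 c2 c3; set y := cube_y F D in r1 r2 r3 c1 c2 c3.
set z := cube_z F D in r1 r2 r3 c1 c2 c3.
have xzy : x + z + y = x + y + z by rewrite addrAC.
have zxy : z + x + y = x + y + z by rewrite -addrA addrC.
have zyx : z + y + x = x + y + z by rewrite [_ + x]addrC addrA addrAC.
have yzx : y + z + x = x + y + z by rewrite [_ + x]addrC addrA.
have yxz : y + x + z = x + y + z by rewrite [y + x]addrC.
apply: Re_rel_of_eq0; rewrite /comm -?mulmxE ?two_d ?l1 ?l2 //.
- rewrite /imgD imgAE imgBE imgCE -/x -/y -/z.
  by apply: racah_Re_alpha; [exact: racah_rel_swap | rewrite xzy].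
- rewrite /imgD -l1 imgAE imgBE imgCE -/x -/y -/z.
  by apply: racah_Re_alpha; [apply: racah_rel_swap; rewrite ?zxy | rewrite zyx].
rewrite /imgD -l2 imgAE imgBE imgCE -/x -/y -/z.
by apply: racah_Re_alpha; [apply: racah_rel_swap; rewrite ?yzx | rewrite yxz].
Qed.

End CubeRacah.

(** Pulls the relations back from matrices to the generated subalgebra. *)
Lemma Re_rel_inj (F : fieldType) (S T : algType F) (f : {rmorphism S -> T})
    (a b c d : S) : injective f ->
  Re_rel (f a) (f b) (f c) (f d) -> Re_rel a b c d.
Proof.
move=> finj [ab bc ca cen].
have fE : (forall p q, f (comm p q) = comm (f p) (f q)) /\
    (forall p, f (2%:R * p) = 2%:R * f p).
  by split=> *; rewrite /comm ?rmorphB ?rmorphM ?rmorph_nat.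
case: fE => fcomm f2.
split; try by apply: finj; rewrite fcomm f2.
move=> e g he hg; apply: finj; rewrite !rmorphM; apply: cen.
  by have := map_f f he; rewrite /= !(rmorphB, rmorphD, rmorphM, fcomm).
exact: (map_f f hg).
Qed.

(** * Existence, surjectivity and uniqueness of the homomorphism *)

Section RacahHom.
Variables (F : numClosedFieldType) (D : nat).
Local Notation M := 'M[F]_((Xn D).+1).
Local Notation R := (gen_type (A2J F D) (A2Jbar F D) (A2star F D)).
Variables (Re : algType F) (A B C Dl : Re).
Hypothesis pres : is_Re_presentation A B C Dl.

Lemma inR_img : [/\ inR (imgA F D), inR (imgB F D), inR (imgC F D) & inR (imgD F D)].
Proof.
have [x y z] := inR_cube F D.
have re_genP (u : M) : inR u -> inR (re_gen u).
  move=> Ru; apply: ga_add; first exact: ga_scale.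
  by apply/gen_algN/ga_scale/ga_one.
have [a b c] : [/\ inR (imgA F D), inR (imgB F D) & inR (imgC F D)].
  by rewrite imgAE imgBE imgCE; split; apply: re_genP.
by split=> //; apply: ga_scale; apply: ga_add; [|apply: gen_algN]; apply: ga_mul.
Qed.

Lemma Re_to_R_exists : exists f : Re -> M,
  [/\ is_alg_hom f /\ (forall x, inR (f x)),
      f A = imgA F D, f B = imgB F D, f C = imgC F D &
      forall N, inR N -> exists x, f x = N].
Proof.
have [hA hB hC hD] := inR_img.
pose g (u : M) (h : inR u) : R := GenType (introT (gen_predP _ _ _ _) h).
(* The universal property is applied with target [R] itself, so that all images lie in the generated
   algebra. *)
have rel : Re_rel (g _ hA) (g _ hB) (g _ hC) (g _ hD).
  apply: (@Re_rel_inj _ R M (val : {rmorphism R -> M})); first exact: val_inj.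
  exact: img_Re_rel.
have [[f [[fD fZ fM f1] fA fB fC _]] _] := pres.2 _ _ _ _ _ rel.
pose F' x : M := val (f x).
have FA : F' A = imgA F D by rewrite /F' fA.
have FB : F' B = imgB F D by rewrite /F' fB.
have FC : F' C = imgC F D by rewrite /F' fC.
have FD x y : F' (x + y) = F' x + F' y by rewrite /F' fD rmorphD.
have FZ k x : F' (k *: x) = k *: F' x by rewrite /F' fZ linearZ.
have FM x y : F' (x * y) = F' x * F' y by rewrite /F' fM rmorphM.
have F1 : F' 1 = 1 by rewrite /F' f1 rmorph1.
exists F'; split=> //.
  by split=> // x; apply/(gen_predP (A2J F D)); exact: gen_valP.
have surj_aff (u : M) (U : Re) (k : F) : F' U = re_gen (2%:R *: u + k%:M) ->
    exists x, F' x = u.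
  move=> e; exists (8%:R *: U - (8%:R * (k / 16%:R - 4%:R^-1)) *: 1).
  rewrite -scaleN1r FD !FZ F1 e -re_gen_affine.
  apply/matrixP => i j; rewrite !mxE.
  by case: (i == j); rewrite /= ?mulr1n ?mulr0n; field.
move=> N; elim=> [| | |
  |M1 M2 _ [x1 <-] _ [x2 <-]|k M1 _ [x <-]|M1 M2 _ [x1 <-] _ [x2 <-]].
- have [u Fu] := surj_aff (A2J F D + A2Jbar F D) A D%:R (etrans FA (imgAE F D)).
  have [v Fv] := surj_aff (A2J F D - A2Jbar F D) C D%:R (etrans FC (imgCE F D)).
  exists (2%:R^-1 *: (u + v)); rewrite FZ FD Fu Fv.
  by apply/matrixP => i j; rewrite !mxlinE; field.
- have [u Fu] := surj_aff (A2J F D + A2Jbar F D) A D%:R (etrans FA (imgAE F D)).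
  have [v Fv] := surj_aff (A2J F D - A2Jbar F D) C D%:R (etrans FC (imgCE F D)).
  exists (2%:R^-1 *: (u + (-1) *: v)); rewrite FZ FD FZ Fu Fv.
  by apply/matrixP => i j; rewrite !mxlinE; field.
- exact: (surj_aff (A2star F D) B D%:R (etrans FB (imgBE F D))).
- by exists 1.
- by exists (x1 + x2).
- by exists (k *: x).
by exists (x1 * x2).
Qed.

(** The image of [Dl] is forced by [2 Dl = [A, B]]. *)
Lemma Re_to_R_unique (f g : Re -> M) : is_alg_hom f -> is_alg_hom g ->
  f A = g A -> f B = g B -> f C = g C ->
  f A = imgA F D -> f B = imgB F D -> f =1 g.
Proof.
move=> hf hg eA eB eC fA fB.
have [_ uniq_hom] := pres.2 _ _ _ _ _ (img_Re_rel F D).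
apply: uniq_hom => //.
have [ab _ _ _] := pres.1.
have Dl_eq (h : Re -> M) : is_alg_hom h -> 2%:R *: h Dl = h A * h B - h B * h A.
  case=> hD hZ hM _; rewrite -hZ scaler_nat -mulr_natl -ab /comm hD.
  by rewrite -[- (B * A)]scaleN1r hZ scaleN1r !hM.
have n2 : (2%:R : F) != 0 by rewrite pnatr_eq0.
by apply: (scalerI n2); rewrite !Dl_eq // -eA -eB.
Qed.

End RacahHom.

(** * Irreducible modules of the generated algebra *)

Section CubeModule.
Variables (F : numClosedFieldType) (D m : nat).
Local Notation n := (Xn D).
Variable rho : 'M[F]_n.+1 -> 'M[F]_m.+1.
Hypothesis rho_mod : is_module (@inR F D) rho.
Hypothesis rho_irr : is_irreducible (@inR F D) rho.
Local Notation P := (@inR F D).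

Let rD r s : P r -> P s -> rho (r + s) = rho r + rho s.
Proof. by have [h _] := rho_mod; apply: h. Qed.
Let rZ k r : P r -> rho (k *: r) = k *: rho r.
Proof. by have [_ [h _]] := rho_mod; apply: h. Qed.
Let rM r s : P r -> P s -> rho (r *m s) = rho r *m rho s.
Proof. by have [_ [_ [h _]]] := rho_mod; apply: h. Qed.
Let r1 : rho 1%:M = 1%:M.
Proof. by have [_ [_ [_ h]]] := rho_mod. Qed.
Let rN r : P r -> rho (- r) = - rho r.
Proof. by move=> Pr; rewrite -!scaleN1r rZ. Qed.
Let rS a : rho a%:M = a%:M.
Proof. by rewrite -scalemx1 rZ ?r1 ?scalemx1 //; apply: ga_one. Qed.

(** [rho] is linear and multiplicative on the generated algebra only, so each rewriting leaves
    membership goals. *)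
Ltac inRtac := repeat first [ assumption | apply: gen_alg_scalar | apply: ga_mul
  | apply: ga_scale | apply: gen_algN | apply: ga_add ].

Lemma rho_racah x y z : P x -> P y -> P z -> racah_rel x y z ->
  racah_rel (rho x) (rho y) (rho z).
Proof.
move=> Px Py Pz /(congr1 rho).
by rewrite /racah_rel !(rD, rZ, rM, rN); inRtac.
Qed.

Lemma rho_comm x y z : P x -> P y -> P z -> comm_mx x (x + y + z) ->
  comm_mx (rho x) (rho x + rho y + rho z).
Proof.
move=> Px Py Pz /(congr1 rho).
by rewrite /comm_mx !(rD, rM); inRtac.
Qed.

Lemma rho_ann x (s : seq F) : P x -> \prod_(t <- s) (x - t%:M) = 0 ->
  \prod_(t <- s) (rho x - t%:M) = 0.
Proof.
move=> Px; suff [_ <-] : P (\prod_(t <- s) (x - t%:M)) /\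
    rho (\prod_(t <- s) (x - t%:M)) = \prod_(t <- s) (rho x - t%:M).
  by move=> ->; rewrite -(scale0r 1%:M) rZ ?scale0r //; apply: ga_one.
elim: s => [|t s [Ps IH]]; first by rewrite !big_nil; split; [exact: ga_one|exact: r1].
have Pt : P (x - t%:M) by inRtac.
rewrite !big_cons; split; first exact: ga_mul.
by rewrite -mulmxE rM // IH rD // ?rN ?rS //; inRtac.
Qed.

(** The three generators are affine combinations of the cube triple, so stability under the triple
    spreads to the whole algebra by induction. *)
Lemma rho_irr_cube (U : 'M[F]_m.+1) :
  (exists Y, rho (cube_x F D) *m U = U *m Y) ->
  (exists Y, rho (cube_y F D) *m U = U *m Y) ->
  (exists Y, rho (cube_z F D) *m U = U *m Y) -> U = 0 \/ \rank U = m.+1.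
Proof.
have PJ : P (A2J F D) by apply: ga_g1.
have PK : P (A2Jbar F D) by apply: ga_g2.
have PS : P (A2star F D) by apply: ga_g3.
move=> [Yx hx] [Yy hy] [Yz hz].
have n4 : (4%:R : F) != 0 by rewrite pnatr_eq0.
have n2 : (2%:R : F) != 0 by rewrite pnatr_eq0.
have JE : A2J F D = 4%:R^-1 *: (cube_x F D + cube_y F D - (2%:R * D%:R)%:M).
  by apply/matrixP => i j; rewrite /cube_x /cube_y !mxE; field.
have KE : A2Jbar F D = 4%:R^-1 *: (cube_x F D - cube_y F D).
  by apply/matrixP => i j; rewrite /cube_x /cube_y !mxE; field.
have SE : A2star F D = 2%:R^-1 *: (cube_z F D - D%:R%:M).
  by rewrite /cube_z addrK scalerA mulVf ?scale1r.
have [] := inR_cube F D; move: JE KE SE hx hy hz.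
move: (cube_x F D) (cube_y F D) (cube_z F D) => x y z JE KE SE hx hy hz Px Py Pz.
apply: rho_irr => r.
elim=> [| | | |M1 M2 P1 [Y1 h1] P2 [Y2 h2]|k M1 P1 [Y1 h1]|M1 M2 P1 [Y1 h1] P2 [Y2 h2]].
- exists (4%:R^-1 *: (Yx + Yy - (2%:R * D%:R)%:M)).
  rewrite JE !(rZ, rD, rN, rS); inRtac.
  rewrite -!scalemxAl -!scalemxAr !(mulmxDl, mulmxDr, mulmxN, mulNmx) hx hy.
  by rewrite scalar_mxC.
- exists (4%:R^-1 *: (Yx - Yy)); rewrite KE !(rZ, rD, rN); inRtac.
  by rewrite -!scalemxAl -!scalemxAr !(mulmxDl, mulmxDr, mulmxN, mulNmx) hx hy.
- exists (2%:R^-1 *: (Yz - D%:R%:M)); rewrite SE !(rZ, rD, rN, rS); inRtac.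
  by rewrite -!scalemxAl -!scalemxAr !(mulmxDl, mulmxDr, mulmxN, mulNmx) hz scalar_mxC.
- by exists 1%:M; rewrite r1 mul1mx mulmx1.
- by exists (Y1 + Y2); rewrite rD // mulmxDl mulmxDr h1 h2.
- by exists (k *: Y1); rewrite rZ // -scalemxAl h1 scalemxAr.
by exists (Y1 *m Y2); rewrite rM // -mulmxA h2 mulmxA h1 mulmxA.
Qed.

Lemma lt_condC k (X Y Z : 'M[F]_k) : lt_cond X Y Z -> lt_cond X Z Y.
Proof. by case=> Q [? ? ? ?]; exists Q. Qed.

Lemma rho_leonard_triple :
  leonard_triple (rho (A2J F D + A2Jbar F D)) (rho (A2star F D))
                 (rho (A2J F D - A2Jbar F D)).
Proof.
have PJ : P (A2J F D) by apply: ga_g1.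
have PK : P (A2Jbar F D) by apply: ga_g2.
have PS : P (A2star F D) by apply: ga_g3.
have n2 : (2%:R : F) != 0 by rewrite pnatr_eq0.
have [Px Py Pz] := inR_cube F D.
have [ra rb rc] := cube_racah F D; have [ca cb cc] := cube_central F D.
have [aa ab ac] := cube_ann F D.
have affE u : P u -> rho u = 2%:R^-1 *: rho (2%:R *: u + D%:R%:M) + (- D%:R / 2%:R)%:M.
  move=> Pu; rewrite rD ?rZ ?rS; inRtac.
  apply/matrixP => i j; rewrite !mxE.
  by case: (i == j); rewrite /= ?mulr1n ?mulr0n; field.
rewrite (affE (A2J F D + A2Jbar F D)); last by inRtac.
rewrite (affE (A2J F D - A2Jbar F D)); last by inRtac.
rewrite (affE (A2star F D)) // -/(cube_x F D) -/(cube_y F D) -/(cube_z F D).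
have a1 := rho_racah Px Py Pz ra; have a2 := rho_racah Py Pz Px rb.
have a3 := rho_racah Pz Px Py rc; have c1 := rho_comm Px Py Pz ca.
have c2 : comm_mx (rho (cube_y F D))
    (rho (cube_y F D) + rho (cube_z F D) + rho (cube_x F D)).
  by apply: rho_comm => //; rewrite [_ + cube_x F D]addrC addrA.
have c3 : comm_mx (rho (cube_z F D))
    (rho (cube_z F D) + rho (cube_x F D) + rho (cube_y F D)).
  by apply: rho_comm => //; rewrite -addrA addrC.
have irr := rho_irr_cube.
have e1 := rho_ann Px aa; have e2 := rho_ann Py ab; have e3 := rho_ann Pz ac.
move: (rho (cube_x F D)) (rho (cube_y F D)) (rho (cube_z F D))
  a1 a2 a3 c1 c2 c3 irr e1 e2 e3.
move=> x y z a1 a2 a3 c1 c2 c3 irr e1 e2 e3.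
have yzx : y + z + x = x + y + z by rewrite [_ + x]addrC addrA.
have zxy : z + x + y = x + y + z by rewrite -addrA addrC.
(* Each operator in turn takes the place of [z] by cyclic rotation; [lt_condC] exchanges the two
   tridiagonal ones. *)
split; apply: lt_cond_affine; rewrite ?invr_eq0 //; apply: lt_condC.
- apply: (@racah_irr_lt_cond _ _ y z x (fun U hy hz hx => irr U hx hy hz) D) => //.
    by rewrite yzx -zxy.
  by rewrite yzx.
- apply: (@racah_irr_lt_cond _ _ x y z irr D) => //; first by rewrite -yzx.
  by rewrite -zxy.
apply: (@racah_irr_lt_cond _ _ z x y (fun U hz hx hy => irr U hx hy hz) D) => //.
  by rewrite zxy.
by rewrite zxy -yzx.
Qed.

End CubeModule.

Theorem theorem1p8 (K : realType) (D : nat) : (2 <= D)%N ->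
  (forall (Re : algType K[i]) (A B C Dl : Re),
     is_Re_presentation A B C Dl ->
     (exists f : Re -> 'M[K[i]]_((Xn D).+1),
        [/\ is_alg_hom f /\ (forall x, inR (f x)),
            f A = imgA K[i] D, f B = imgB K[i] D, f C = imgC K[i] D &
            forall M, inR M -> exists x, f x = M]) /\
     (forall f g : Re -> 'M[K[i]]_((Xn D).+1),
        [/\ is_alg_hom f, (forall x, inR (f x)),
            f A = imgA K[i] D, f B = imgB K[i] D & f C = imgC K[i] D] ->
        [/\ is_alg_hom g, (forall x, inR (g x)),
            g A = imgA K[i] D, g B = imgB K[i] D & g C = imgC K[i] D] ->
        f =1 g)) /\
  (forall (m : nat) (rho : 'M[K[i]]_((Xn D).+1) -> 'M[K[i]]_m.+1),
     is_module (@inR K[i] D) rho -> is_irreducible (@inR K[i] D) rho ->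
     leonard_triple (rho (A2J K[i] D + A2Jbar K[i] D)) (rho (A2star K[i] D))
                    (rho (A2J K[i] D - A2Jbar K[i] D))).
Proof.
move=> _; split=> [Re A B C Dl pres|m rho rmod rirr].
  split; first exact: (Re_to_R_exists D pres).
  move=> f g [hf _ fA fB fC] [hg _ gA gB gC].
  exact: (Re_to_R_unique pres hf hg (etrans fA (esym gA)) (etrans fB (esym gB))
    (etrans fC (esym gC)) fA fB).
exact: rho_leonard_triple.
Qed.
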